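(* Let $\Gamma$ be a stable weighted graph of weighted genus $g\ge2$ with $3g-4$ edges and total weight $0$. Then $R(\Gamma)$ is isomorphic to one of $\{\mathrm{id}\}$, $\mathbb Z/2\mathbb Z$, $\mathbb Z/3\mathbb Z$, $S_3$; the coarse moduli space of the orbifold $[\overline{\mathcal M}_{0,4}/R(\Gamma)]$ is $\mathbb P^1$; and the orders of its points are as follows: $$ \begin{array}{c|c} R(\Gamma) & [\overline{\mathcal M}_{0,4}/R(\Gamma)]\\ \hline \{\mathrm{id}\} & [1,1,1\,|\,\emptyset]\\ \mathbb Z/2\mathbb Z & [1,2\,|\,2]\\ \mathbb Z/3\mathbb Z & [1\,|\,3,3]\\ S_3 & [2\,|\,2,3] \end{array} $$ Here $[\underline a\,|\,\underline b]$ means that $\underline a$ is the list of orders of the points of $[\overline{\mathcal M}_{0,4}/R(\Gamma)]$ lying in the image of the boundary $\overline{\mathcal M}_{0,4}\setminus\mathcal M_{0,4}$, and $\underline b$ is the list of orders of the remaining orbifold points (points with non-trivial stabilizer).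
   Context: The base is a field $k$ with $\mathrm{char}(k)\neq2$ containing the cubic roots of $-1$, including an element $\xi\ne-1$ with $\xi^3=-1$. Weighted graphs. A weighted graph $\Gamma$ is a finite graph (loops and multiple edges allowed) with a weight function $w:V(\Gamma)\to\mathbb N$ ($0$ allowed). $\deg(v)$ is the number of edges at $v$, loops counted twice; $\mathrm{mult}(v)=3w(v)+\deg(v)$; the total weight is $\sum_v w(v)$ and the weighted genus is $g=\sum_v w(v)+|E(\Gamma)|-|V(\Gamma)|+1$. $\Gamma$ is stable if it is connected, $g\ge2$ and $\mathrm{mult}(v)\ge3$ for all $v$. If $\Gamma$ is stable of weighted genus $g$ with $3g-4$ edges and total weight $0$, then exactly one vertex $v_0$ has degree $4$ and all other vertices have degree $3$. $\mathrm{Aut}(\Gamma)$ is the group of weight-preserving automorphisms of $\Gamma$ acting on vertices and half-edges (so parallel edges can be exchanged and each loop can be flipped). Let $e_1,\dots,e_4$ be the four half-edges at $v_0$ and $\sigma:\mathrm{Aut}(\Gamma)\to S_4$ the homomorphism giving the induced permutation of them. $V_4\subset S_4$ is the normal Klein four-subgroup, and $R(\Gamma):=\mathrm{Aut}(\Gamma)/\sigma^{-1}(V_4)\subseteq S_4/V_4\cong S_3$. $S_4$ acts on $\overline{\mathcal M}_{0,4}\cong\mathbb P^1$ (via the cross ratio) by permuting the marked points, with $V_4$ acting trivially, so $R(\Gamma)$ acts on $\overline{\mathcal M}_{0,4}$; the boundary $\overline{\mathcal M}_{0,4}\setminus\mathcal M_{0,4}$ corresponds to $\{0,1,\infty\}$.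 The order of a point of the orbifold $[\overline{\mathcal M}_{0,4}/R(\Gamma)]$ is the order of its stabilizer group. *)

(* Defs.v *)
From HB Require Import structures.
From mathcomp Require Import all_boot all_order all_fingroup all_algebra.
From mathcomp Require Import all_solvable.
From mathcomp Require Import mpoly.
From mathcomp Require Import ring zify.

Set Implicit Arguments.
Unset Strict Implicit.
Unset Printing Implicit Defensive.

Import GroupScope GRing.Theory.
Local Open Scope ring_scope.

Definition i4 (j : nat) : 'I_4 := inord j.

Definition V4 : {set 'S_4} :=
  let t (j l : nat) : 'S_4 := tperm (i4 j) (i4 l) in
  [set 1; t 0%N 1%N * t 2%N 3%N; t 0%N 2%N * t 1%N 3%N;
          t 0%N 3%N * t 1%N 2%N]%g.

Lemma ord4P (Q : 'I_4 -> Prop) :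
  Q (i4 0) -> Q (i4 1) -> Q (i4 2) -> Q (i4 3) -> forall i, Q i.
Proof.
move=> q0 q1 q2 q3 [[|[|[|[|//]]]] lt].
- by rewrite (_ : Ordinal lt = i4 0) //; apply: val_inj; rewrite /= inordK.
- by rewrite (_ : Ordinal lt = i4 1) //; apply: val_inj; rewrite /= inordK.
- by rewrite (_ : Ordinal lt = i4 2) //; apply: val_inj; rewrite /= inordK.
- by rewrite (_ : Ordinal lt = i4 3) //; apply: val_inj; rewrite /= inordK.
Qed.

Lemma i4_eq (j k : nat) : (j < 4)%N -> (k < 4)%N -> (i4 j == i4 k) = (j == k).
Proof. by move=> lj lk; rewrite -val_eqE /= !inordK. Qed.

Lemma dtpermE (i j k l a : 'I_4) : uniq [:: i; j; k; l] -> a \in [:: i; j; k; l] ->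
    ((tperm i j * tperm k l : 'S_4)^-1)%g a =
    if a == i then j else if a == j then i else if a == k then l else k.
Proof.
  rewrite /= !inE !negb_or -!andbA => /and5P[ij ik il jk /andP[jl /andP[kl _]]] ha.
  rewrite invMg !tpermV permM.
  case/or4P: ha => /eqP->.
  - by rewrite eqxx (@tpermD _ k l i) 1?eq_sym // tpermL.
  - by rewrite (@tpermD _ k l j) 1?eq_sym // tpermR (negPf ij) eqxx.
  - rewrite tpermL (@tpermD _ i j l) // eqxx.
    by rewrite ![k == _]eq_sym (negPf ik) (negPf jk).
  - rewrite tpermR (@tpermD _ i j k) //.
    by rewrite ![l == _]eq_sym (negPf il) (negPf jl) (negPf kl).
Qed.

Lemma V4_dtperm (i j k l : 'I_4) :
  uniq [:: i; j; k; l] -> (tperm i j * tperm k l)%g \in V4.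
Proof.
have C (x y z t : 'I_4) : uniq [:: x; y; z; t] ->
    (tperm x y * tperm z t = tperm z t * tperm x y)%g.
  rewrite /= !inE !negb_or -!andbA => /and5P[xy xz xt yz /andP[yt _]].
  by apply/commgP/conjg_fixP; rewrite tpermJ !tpermD // eq_sym.
move=> u; rewrite !inE.
have C1 : (tperm (i4 2) (i4 3) * tperm (i4 0) (i4 1) =
           tperm (i4 0) (i4 1) * tperm (i4 2) (i4 3))%g.
  by apply: C; rewrite /= !inE !i4_eq.
have C2 : (tperm (i4 1) (i4 3) * tperm (i4 0) (i4 2) =
           tperm (i4 0) (i4 2) * tperm (i4 1) (i4 3))%g.
  by apply: C; rewrite /= !inE !i4_eq.
have C3 : (tperm (i4 1) (i4 2) * tperm (i4 0) (i4 3) =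
           tperm (i4 0) (i4 3) * tperm (i4 1) (i4 2))%g.
  by apply: C; rewrite /= !inE !i4_eq.
have {u} : [&& i != j, i != k, j != k, i != l, j != l & k != l].
  move: u; rewrite /= !inE !negb_or -!andbA andbT.
  by case/and5P=> -> -> -> -> /andP[-> ->].
move: i j; apply: ord4P; apply: ord4P; rewrite ?eqxx ?i4_eq //=;
  move: k; apply: ord4P; rewrite ?eqxx ?i4_eq //=;
  move: l; apply: ord4P; rewrite ?eqxx ?i4_eq //= => _.
all: rewrite ?(tpermC (i4 1) (i4 0)) ?(tpermC (i4 2) (i4 0))
  ?(tpermC (i4 2) (i4 1)) ?(tpermC (i4 3) (i4 0)) ?(tpermC (i4 3) (i4 1))
  ?(tpermC (i4 3) (i4 2)).
all: by rewrite ?C1 ?C2 ?C3 ?eqxx ?orbT.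
Qed.

Lemma V4P (s : 'S_4) :
  reflect (s = 1%g \/ exists i j k l : 'I_4,
             uniq [:: i; j; k; l] /\ s = (tperm i j * tperm k l)%g)
          (s \in V4).
Proof.
apply: (iffP idP) => [|[->|[i [j [k [l [u ->]]]]]]]; last exact: V4_dtperm.
  rewrite !inE -!orbA => /or4P[]/eqP->; [by left | right..].
  - by exists (i4 0), (i4 1), (i4 2), (i4 3); rewrite /= !inE !i4_eq.
  - by exists (i4 0), (i4 2), (i4 1), (i4 3); rewrite /= !inE !i4_eq.
  - by exists (i4 0), (i4 3), (i4 1), (i4 2); rewrite /= !inE !i4_eq.
by rewrite !inE eqxx.
Qed.

Lemma V4_norm (g : 'S_4) : g \in 'N(V4)%g.
Proof.
rewrite inE; apply/subsetP => _ /imsetP[s /V4P[->|[i [j [k [l [u ->]]]]]] ->].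
  by rewrite conj1g; apply/V4P; left.
rewrite conjMg !tpermJ; apply/V4P; right.
exists (g i), (g j), (g k), (g l); split=> //.
by have := u; rewrite /= !inE !(inj_eq perm_inj).
Qed.

Lemma V4_group_set : group_set V4.
Proof.
have I (a b : 'S_4) : (a^-1)%g = (b^-1)%g -> a = b by exact: invg_inj.
apply/group_setP; split=> [|a b]; first by rewrite !inE eqxx.
rewrite /V4 !inE -!orbA => /or4P[]/eqP-> /or4P[]/eqP->; rewrite ?mul1g ?mulg1;
  rewrite ?eqxx ?orbT //.
all: apply/or4P; first
  [ apply: Or41; apply/eqP/I/permP; apply: ord4P;
    by rewrite [in LHS]invMg permM !dtpermE /= ?inE ?i4_eq //= ?invg1 ?perm1
  | apply: Or42; apply/eqP/I/permP; apply: ord4P;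
    by rewrite [in LHS]invMg permM !dtpermE /= ?inE ?i4_eq //= ?invg1 ?perm1
  | apply: Or43; apply/eqP/I/permP; apply: ord4P;
    by rewrite [in LHS]invMg permM !dtpermE /= ?inE ?i4_eq //= ?invg1 ?perm1
  | apply: Or44; apply/eqP/I/permP; apply: ord4P;
    by rewrite [in LHS]invMg permM !dtpermE /= ?inE ?i4_eq //= ?invg1 ?perm1 ].
Qed.
Canonical V4_group := Group V4_group_set.

(** * Weighted graphs *)

(* An edge is an orbit of the involution [other_half] on half-edges, so loops and
   multiple edges are allowed; a loop has both half-edges at the same vertex. *)
Record wgraph := WGraph {
  vertex : finType;
  halfedge : finType;
  endpoint : halfedge -> vertex;
  other_half : halfedge -> halfedge;
  weight : vertex -> nat;
  other_halfK : involutive other_half;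
  other_half_neq : forall h, other_half h != h }.

Section Graph.
Variable Gam : wgraph.
Local Notation V := (vertex Gam).
Local Notation H := (halfedge Gam).

Definition edges : {set {set H}} := [set [set h; other_half h] | h : H].
Definition star (v : V) : {set H} := [set h | endpoint h == v].
Definition vdeg (v : V) : nat := #|star v|.
Definition vmult (v : V) : nat := 3 * weight v + vdeg v.
Definition total_weight : nat := \sum_(v : V) weight v.
Definition genus : int := total_weight%:Z + #|edges|%:Z - #|V|%:Z + 1.

Definition adjacent : rel V :=
  [rel u v | [exists h, (endpoint h == u) && (endpoint (other_half h) == v)]].
Definition connected : Prop :=
  (0 < #|V|)%N /\ forall u v : V, connect adjacent u v.

Definition stable_graph : Prop :=
  [/\ connected, (2 <= genus)%R & forall v, (3 <= vmult v)%N].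

Definition is_aut (a : {perm V} * {perm H}) : bool :=
  [&& [forall h, endpoint (a.2 h) == a.1 (endpoint h)],
      [forall h, other_half (a.2 h) == a.2 (other_half h)]
    & [forall v, weight (a.1 v) == weight v]].

Definition graph_aut : {set {perm V} * {perm H}} := [set a | is_aut a].

Lemma graph_autP (a : {perm V} * {perm H}) :
  reflect [/\ forall h, endpoint (a.2 h) = a.1 (endpoint h),
              forall h, other_half (a.2 h) = a.2 (other_half h)
            & forall v, weight (a.1 v) = weight v] (a \in graph_aut).
Proof.
rewrite inE; apply: (iffP and3P) => [[/forallP r /forallP f /forallP w]|[r f w]].
  by split=> x; apply/eqP.
by split; apply/forallP => x; apply/eqP.
Qed.

Lemma graph_aut_group_set : group_set graph_aut.
Proof.
apply/group_setP; split.
  by apply/graph_autP; split=> x /=; rewrite !perm1.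
move=> a b /graph_autP[ra fa wa] /graph_autP[rb fb wb].
by apply/graph_autP; split=> x /=; rewrite !permM ?rb ?ra ?fb ?fa ?wb ?wa.
Qed.
Canonical graph_aut_group := Group graph_aut_group_set.

(* The permutation of {0,1,2,3} induced by an automorphism through a labelling
   [e] of four half-edges; the default value 1 is irrelevant when the
   automorphism permutes these half-edges, see [sigmaE] and [sigmaM]. *)
Definition sigma (e : 4.-tuple H) (a : {perm V} * {perm H}) : 'S_4 :=
  odflt 1%g [pick s : 'S_4 | [forall i, tnth e (s i) == a.2 (tnth e i)]].

Definition sigma_preim_V4 (e : 4.-tuple H) : {set {perm V} * {perm H}} :=
  [set a in graph_aut | sigma e a \in V4].

(* R(Gam). This is a quotient of groups by [sigma_preim_V4_normal]. *)
Definition Rgroup (e : 4.-tuple H) : {set coset_of (sigma_preim_V4 e)} :=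
  (graph_aut / sigma_preim_V4 e)%g.


Lemma card_half : (#|H| = #|edges| * 2)%N.
Proof.
pose D : {set H} := setT.
have fK : forall h : H, other_half (other_half h) = h := @other_halfK Gam.
have tr : trivIset edges.
  apply/trivIsetP => _ _ /imsetP[x _ ->] /imsetP[y _ ->] neq.
  rewrite -setI_eq0; apply/eqP/setP => h; rewrite !inE.
  apply/negP => /andP[/orP[]/eqP-> /orP[]/eqP exy]; move: neq; apply/negP;
    rewrite negbK; apply/eqP.
  - by rewrite exy.
  - by rewrite exy fK setUC.
  - by rewrite -exy fK setUC.
  - by rewrite -(fK x) exy fK.
have cov : cover edges = [set: H].
  apply/setP => h; rewrite inE; apply/bigcupP; exists [set h; other_half h].
    exact: imset_f.
  by rewrite !inE eqxx.
have /eqP := tr; rewrite cov cardsT => <-.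
rewrite (eq_bigr (fun _ => 2%N)) ?sum_nat_const // => _ /imsetP[h _ ->].
by rewrite cards2 eq_sym other_half_neq.
Qed.

Lemma sum_deg : (\sum_(v : V) vdeg v = #|edges| * 2)%N.
Proof.
rewrite -card_half -sum1_card (partition_big (@endpoint Gam) predT) //=.
by apply: eq_bigr => v _; rewrite sum1_card /vdeg; apply: eq_card => h; rewrite inE.
Qed.

Lemma deg4_vertex :
  stable_graph -> #|edges|%:Z = 3 * genus - 4 -> total_weight = 0%N ->
  exists v0 : V, vdeg v0 = 4%N /\ forall v : V, v != v0 -> vdeg v = 3%N.
Proof.
move=> [_ _ st] eE w0.
have w (v : V) : weight v = 0%N.
  by move/eqP: w0; rewrite sum_nat_eq0 => /forallP/(_ v)/eqP.
have d3 (v : V) : (3 <= vdeg v)%N by have := st v; rewrite /vmult w.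
have sD : (\sum_(v : V) (vdeg v - 3) = 1)%N.
  have : (\sum_(v : V) (vdeg v - 3) + #|V| * 3 = #|edges| * 2)%N.
    rewrite -sum_deg -sum_nat_const -big_split /=.
    by apply: eq_bigr => v _; rewrite subnK.
  move: eE; rewrite /genus w0; lia.
have [v0 hv0] : exists v0 : V, (0 < vdeg v0 - 3)%N.
  apply/existsP; apply: contraT; rewrite negb_exists => /forallP h.
  by move: sD; rewrite big1 // => v _; apply/eqP; have := h v; rewrite lt0n negbK.
exists v0; move: sD; rewrite (bigD1 v0) //= => sD; split.
  by have := d3 v0; lia.
move=> v nv; have : (\sum_(v | v != v0) (vdeg v - 3) == 0)%N by lia.
rewrite sum_nat_eq0 => /forallP/(_ v)/implyP/(_ nv).
by have := d3 v; lia.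
Qed.

Section Sigma.
Variables (v0 : V) (e : 4.-tuple H).
Hypothesis labelling : perm_eq e (enum (star v0)).
Hypothesis uniq4 : forall v : V, vdeg v = 4%N -> v = v0.

Lemma sigmaE a : a \in graph_aut ->
  forall i, tnth e (sigma e a i) = a.2 (tnth e i).
Proof.
have ue : uniq e by rewrite (perm_uniq labelling) enum_uniq.
have me h : (h \in e) = (endpoint h == v0).
  by rewrite (perm_mem labelling) mem_enum inE.
have de : vdeg v0 = 4%N by rewrite /vdeg cardE -(perm_size labelling) size_tuple.
move=> /graph_autP[ra fa wa].
have fv0 : a.1 v0 = v0.
  apply: uniq4; rewrite -de /vdeg -(card_imset (star v0) (@perm_inj _ a.2)).
  apply: eq_card => h; rewrite inE; apply/eqP/imsetP => [rh|[h' ]].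
    exists (a.2^-1%g h); rewrite ?permKV //.
    by rewrite inE -(inj_eq (@perm_inj _ a.1)) -ra permKV rh.
  by rewrite inE => /eqP r ->; rewrite ra r.
have ex i : exists j, tnth e j = a.2 (tnth e i).
  suff /tnthP[j ->] : a.2 (tnth e i) \in e by exists j.
  by rewrite me ra (eqP (_ : endpoint _ == v0)) ?fv0 // -me mem_tnth.
have /fin_all_exists[s sE] := ex.
have ei : injective (tnth e) by apply/injectiveP; rewrite /injectiveb/dinjectiveb map_tnth_enum.
have si : injective s.
  by move=> i j sij; apply/ei/(@perm_inj _ a.2); rewrite -!sE sij.
rewrite /sigma; case: pickP => [t /forallP ht i|/(_ (perm si))/forallP[] i].
  exact/eqP.
by rewrite permE sE.
Qed.

Lemma sigmaM : {in graph_aut &, {morph sigma e : a b / (a * b)%g}}.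
Proof.
move=> a b aA bA; apply/permP => i.
have ue : uniq e by rewrite (perm_uniq labelling) enum_uniq.
have ei : injective (tnth e) by apply/injectiveP; rewrite /injectiveb/dinjectiveb map_tnth_enum.
by apply: ei; rewrite permM !sigmaE ?groupM //= permM.
Qed.

Lemma sigma_preim_V4_group_set : group_set (sigma_preim_V4 e).
Proof.
apply/group_setP; split=> [|a b].
  apply/setIdP; split; first exact: group1.
  suff -> : sigma e 1%g = 1%g by rewrite group1.
  by apply: (mulgI (sigma e 1%g)); rewrite -sigmaM ?group1 // !mulg1.
move=> /setIdP[aA aV] /setIdP[bA bV]; apply/setIdP.
by split; rewrite ?sigmaM // groupM.
Qed.

Lemma sigma_preim_V4_normal : (sigma_preim_V4 e <| graph_aut)%g.
Proof.
apply/andP; split; first by apply/subsetP => a /setIdP[].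
apply/subsetP => a aA; rewrite inE; apply/subsetP => _ /imsetP[b /setIdP[bA bV] ->].
apply/setIdP; split; first exact: groupJ.
have -> : (sigma e (b ^ a) = sigma e b ^ sigma e a)%g.
  by apply: (mulgI (sigma e a)); rewrite -sigmaM ?groupJ // -!conjgC sigmaM.
by rewrite memJ_norm // V4_norm.
Qed.
End Sigma.

End Graph.

(** * The projective line and M_{0,4}-bar *)

Section P1.
Variable K : fieldType.

(* [Some a] is the point (a : 1) and [None] is the point (1 : 0). *)
Definition P1 := option K.

Definition hcoord (P : P1) : 'I_2 -> K :=
  fun i => if P is Some a then if i == ord0 then a else 1
           else if i == ord0 then 1 else 0.

(* The point (x : y), for (x, y) <> (0, 0). *)
Definition of_hcoord (x y : K) : P1 := if y == 0 then None else Some (x / y).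

Definition bracket (P Q : P1) : K :=
  hcoord P ord0 * hcoord Q ord_max - hcoord Q ord0 * hcoord P ord_max.

(* ((p0 - p2)(p1 - p3) : (p0 - p3)(p1 - p2)), a well-defined point of P^1 as
   soon as no three of the four points coincide; the points 0, 1, oo are its
   values when two of the points coincide. *)
Definition cross_ratio (p : 'I_4 -> P1) : P1 :=
  of_hcoord (bracket (p (i4 0)) (p (i4 2)) * bracket (p (i4 1)) (p (i4 3)))
            (bracket (p (i4 0)) (p (i4 3)) * bracket (p (i4 1)) (p (i4 2))).

(* A configuration of cross ratio [P]. *)
Definition std_config (P : P1) : 'I_4 -> P1 :=
  tnth [tuple P; Some 1; Some 0; None].

(* The action of S_4 on M_{0,4}-bar = P^1: the point marked [i] becomes the
   point marked [s i]. Mathcomp's permutations compose from left to right, so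
   this is a right action. By [m04_act_cross_ratio] the configuration used to
   represent [P] is irrelevant. *)
Definition m04_act (P : P1) (s : 'S_4) : P1 :=
  cross_ratio (fun i => std_config P ((s^-1)%g i)).

Definition boundary : pred P1 := [pred P | P \in [:: Some 0; Some 1; None]].


Lemma of_hcoordZ (c x y : K) : c != 0 ->
  of_hcoord (c * x) (c * y) = of_hcoord x y.
Proof.
move=> c0; rewrite /of_hcoord mulf_eq0 (negPf c0) /=.
by case: ifP => // y0; congr Some; rewrite invfM mulrACA divff // mul1r.
Qed.

Lemma bracket_eq0 (P Q : P1) : (bracket P Q == 0) = (P == Q).
Proof.
case: P Q => [a|] [b|]; rewrite /bracket /= ?mulr1 ?mul1r ?mulr0 ?mul0r ?subrr ?subr0 ?eqxx //.
- by rewrite subr_eq0.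
- by rewrite sub0r oppr_eq0 oner_eq0.
- by rewrite oner_eq0.

Qed.

Lemma bracket_scale (p q : 'I_4 -> P1) (c : K) :
  bracket (p (i4 0)) (p (i4 2)) * bracket (p (i4 1)) (p (i4 3)) =
    c * (bracket (q (i4 0)) (q (i4 2)) * bracket (q (i4 1)) (q (i4 3))) ->
  bracket (p (i4 0)) (p (i4 3)) * bracket (p (i4 1)) (p (i4 2)) =
    c * (bracket (q (i4 0)) (q (i4 3)) * bracket (q (i4 1)) (q (i4 2))) ->
  forall i j k l : 'I_4, uniq [:: i; j; k; l] ->
  bracket (p i) (p j) * bracket (p k) (p l) =
    c * (bracket (q i) (q j) * bracket (q k) (q l)).
Proof.
move=> hB hC.
have hA : bracket (p (i4 0)) (p (i4 1)) * bracket (p (i4 2)) (p (i4 3)) =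
    c * (bracket (q (i4 0)) (q (i4 1)) * bracket (q (i4 2)) (q (i4 3))).
  have E (r : 'I_4 -> P1) :
    bracket (r (i4 0)) (r (i4 1)) * bracket (r (i4 2)) (r (i4 3)) =
    bracket (r (i4 0)) (r (i4 2)) * bracket (r (i4 1)) (r (i4 3)) -
    bracket (r (i4 0)) (r (i4 3)) * bracket (r (i4 1)) (r (i4 2)).
    by rewrite /bracket; ring.
  by rewrite (E p) (E q) hB hC; ring.
have N (r : 'I_4 -> P1) i j : bracket (r j) (r i) = - bracket (r i) (r j).
  by rewrite /bracket; ring.
move=> i j k l u.
have {u} : [&& i != j, i != k, j != k, i != l, j != l & k != l].
  move: u; rewrite /= !inE !negb_or -!andbA andbT.
  by case/and5P=> -> -> -> -> /andP[-> ->].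
move: i j; apply: ord4P; apply: ord4P; rewrite ?eqxx ?i4_eq //=;
  move: k; apply: ord4P; rewrite ?eqxx ?i4_eq //=;
  move: l; apply: ord4P; rewrite ?eqxx ?i4_eq //= => _.
all: rewrite ?(N p (i4 0) (i4 1)) ?(N p (i4 0) (i4 2)) ?(N p (i4 0) (i4 3))
    ?(N p (i4 1) (i4 2)) ?(N p (i4 1) (i4 3)) ?(N p (i4 2) (i4 3))
    ?(N q (i4 0) (i4 1)) ?(N q (i4 0) (i4 2)) ?(N q (i4 0) (i4 3))
    ?(N q (i4 1) (i4 2)) ?(N q (i4 1) (i4 3)) ?(N q (i4 2) (i4 3)).
all: rewrite ?mulrNN ?mulNr ?mulrN ?mulNr ?mulrN ?opprK; try congr (- _).
all: try by [rewrite ?hA ?hB ?hC | rewrite mulrC ?hA ?hB ?hC; congr (_ * _); rewrite mulrC].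
Qed.

Definition semistable (p : 'I_4 -> P1) : Prop :=
  forall i j k, uniq [:: i; j; k] -> ~ (p i = p j /\ p j = p k).

Let std (P : P1) : (std_config P (i4 0) = P) * (std_config P (i4 1) = Some 1) *
  (std_config P (i4 2) = Some 0) * (std_config P (i4 3) = None).
Proof. by rewrite /std_config /i4 !(tnth_nth None) !inordK. Qed.

Lemma cross_ratio_std (P : P1) : cross_ratio (std_config P) = P.
Proof.
rewrite /cross_ratio /= !std /bracket; case: P => [a|] /=.
  rewrite [X in of_hcoord X _](_ : _ = -1 * a); last by ring.
  rewrite [X in of_hcoord _ X](_ : _ = -1 * 1); last by ring.
  by rewrite of_hcoordZ ?oppr_eq0 ?oner_eq0 // /of_hcoord oner_eq0 divr1.
rewrite [X in of_hcoord _ X](_ : _ = 0); last by ring.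
by rewrite /of_hcoord eqxx.
Qed.

Lemma m04_act_cross_ratio (p : 'I_4 -> P1) (s : 'S_4) : semistable p ->
  m04_act (cross_ratio p) s = cross_ratio (fun i => p ((s^-1)%g i)).
Proof.
move=> ss; set P := cross_ratio p.
set B := bracket (p (i4 0)) (p (i4 2)) * bracket (p (i4 1)) (p (i4 3)).
set C := bracket (p (i4 0)) (p (i4 3)) * bracket (p (i4 1)) (p (i4 2)).
have BC0 : ~ (B = 0 /\ C = 0).
  move=> [/eqP]; rewrite mulf_eq0 !bracket_eq0 => hB /eqP.
  rewrite mulf_eq0 !bracket_eq0 => hC.
  case/orP: hB => /eqP e1; case/orP: hC => /eqP e2.
  - by apply: (ss (i4 2) (i4 0) (i4 3)); rewrite /= ?inE ?i4_eq // -e1 e2.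
  - by apply: (ss (i4 0) (i4 2) (i4 1)); rewrite /= ?inE ?i4_eq // e1 e2.
  - by apply: (ss (i4 0) (i4 3) (i4 1)); rewrite /= ?inE ?i4_eq // e1 e2.
  - by apply: (ss (i4 3) (i4 1) (i4 2)); rewrite /= ?inE ?i4_eq // -e1 e2.
have [c c0 [hB hC]] : exists2 c, c != 0 &
    B = c * (bracket (std_config P (i4 0)) (std_config P (i4 2)) *
             bracket (std_config P (i4 1)) (std_config P (i4 3))) /\
    C = c * (bracket (std_config P (i4 0)) (std_config P (i4 3)) *
             bracket (std_config P (i4 1)) (std_config P (i4 2))).
  rewrite !std /P /cross_ratio -/B -/C /of_hcoord /bracket /=.
  case: eqP => [C0|/eqP C0] /=.
    exists (- B); first by rewrite oppr_eq0; apply/eqP => B0; apply: BC0.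
    by split; [ring | rewrite C0; ring].
  by exists (- C); rewrite ?oppr_eq0 //; split; field.
have Q := bracket_scale hB hC.
rewrite [RHS]/cross_ratio !Q ?of_hcoordZ //=.
  by rewrite !inE !(inj_eq perm_inj) !i4_eq.
by rewrite !inE !(inj_eq perm_inj) !i4_eq.
Qed.

Lemma std_config_semistable (P : P1) : semistable (std_config P).
Proof.
have n10 : Some (1 : K) = Some 0 -> False.
  by move=> [/eqP]; rewrite oner_eq0.
apply: ord4P; apply: ord4P; apply: ord4P; rewrite /= !inE !i4_eq //= => _;
  rewrite !std => -[e1 e2]; apply: n10; move: e1 e2; rewrite /P1 => e1 e2;
  by first [exact: e1 | exact: e2 | exact: esym e1 | exact: esym e2 | by rewrite e1 e2 | by rewrite -e1 -e2 | by rewrite -e2 -e1 | by rewrite e1 -e2 | by rewrite -e1 e2 | congruence | discriminate e1 | discriminate e2].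
Qed.

Lemma m04_act1 (P : P1) : m04_act P 1%g = P.
Proof.
rewrite -[RHS]cross_ratio_std /m04_act /cross_ratio /=.
by rewrite invg1 !perm1.
Qed.

Lemma m04_actM (P : P1) (s t : 'S_4) :
  m04_act P (s * t)%g = m04_act (m04_act P s) t.
Proof.
rewrite -[m04_act P s]/(cross_ratio _) m04_act_cross_ratio; last first.
  move=> i j k u; apply: std_config_semistable.
  by move: u; rewrite /= !inE !(inj_eq perm_inj).
by rewrite /m04_act /cross_ratio /= invMg !permM.
Qed.

Lemma m04_act_V4 (P : P1) (s : 'S_4) : s \in V4 -> m04_act P s = P.
Proof.
rewrite /V4 !inE -!orbA -[P in _ -> _ = P]cross_ratio_std.
rewrite /m04_act /cross_ratio.
case/or4P=> /eqP->; first by rewrite invg1 !perm1.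
all: rewrite !dtpermE /= ?inE ?i4_eq //= !std; congr of_hcoord; rewrite /bracket; ring.
Qed.

End P1.

(* The action of R(Gam), a quotient of Aut(Gam); the choice of the
   representative is irrelevant by [R_act_coset]. *)
Definition R_act (Gam : wgraph) (e : 4.-tuple (halfedge Gam)) (K : fieldType)
    (P : P1 K) (c : coset_of (sigma_preim_V4 e)) : P1 K :=
  m04_act P (sigma e (repr c)).

Lemma R_act_coset (Gam : wgraph) (v0 : vertex Gam) (e : 4.-tuple (halfedge Gam))
    (K : fieldType) (P : P1 K) a :
  perm_eq e (enum (star v0)) -> (forall v : vertex Gam, vdeg v = 4%N -> v = v0) ->
  a \in graph_aut Gam ->
  R_act P (coset (sigma_preim_V4 e) a) = m04_act P (sigma e a).
Proof.
move=> lab u aA; pose K4 := Group (sigma_preim_V4_group_set lab u).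
have aN : (a \in 'N(K4))%g.
  exact: (subsetP (normal_norm (sigma_preim_V4_normal lab u))).
rewrite /R_act; have : repr (coset K4 a) \in coset K4 a.
  by rewrite mem_repr_coset.
rewrite {2}(val_coset aN) => /rcosetP[b]; case/setIdP=> bA bV ->.
by rewrite (sigmaM lab u) // m04_actM (m04_act_V4 P bV).
Qed.

(** * The orbifold [P^1/G] *)

Section Orbifold.
Variables (gT : finGroupType) (G : {set gT}).
Variable act : forall K : fieldType, P1 K -> gT -> P1 K.

Section Points.
Variable K : fieldType.

Definition same_orbit (P Q : P1 K) : Prop := exists2 g, g \in G & act P g = Q.

Definition point_order (P : P1 K) : nat := #|[set g in G | act P g == P]|.

(* [os] is the list, up to order, of the orders of the points of [P^1/G], i.e.
   of the orbits, that meet [X]; the sequence [ps] contains one representative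
   of each of these orbits. *)
Definition orders_of (X : P1 K -> Prop) (os : seq nat) : Prop :=
  exists ps : seq (P1 K),
    [/\ forall P, P \in ps -> X P,
        forall P, X P -> exists2 Q, Q \in ps & same_orbit P Q,
        forall i j, (i < size ps)%N -> (j < size ps)%N ->
          same_orbit (nth None ps i) (nth None ps j) -> i = j
      & perm_eq [seq point_order P | P <- ps] os].

Definition boundary_image (P : P1 K) : Prop :=
  exists2 B, B \in @boundary K & same_orbit B P.

(* The symbol [a | b]. *)
Definition orbifold_type (a b : seq nat) : Prop :=
  orders_of boundary_image a /\
  orders_of (fun P => ~ boundary_image P /\ (1 < point_order P)%N) b.

End Points.

(* The value of a binary form over [k] at the chosen homogeneous coordinates of
   a point with coordinates in an extension [K] of [k]. *)
Definition form_at (k K : fieldType) (f : {rmorphism k -> K})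
    (F : {mpoly k[2]}) (P : P1 K) : K := (map_mpoly f F).@[hcoord P].

Definition map_P1 (k K : fieldType) (f : {rmorphism k -> K})
    (F0 F1 : {mpoly k[2]}) (P : P1 K) : P1 K :=
  of_hcoord (form_at f F0 P) (form_at f F1 P).

(* (F0 : F1) is a morphism P^1 -> P^1 over [k] given by forms of degree [d]. *)
Definition is_P1_morphism (k : fieldType) (d : nat) (F0 F1 : {mpoly k[2]}) :=
  [/\ F0 \is d.-homog, F1 \is d.-homog
    & forall (K : fieldType) (f : {rmorphism k -> K}) (P : P1 K),
        (form_at f F0 P != 0) || (form_at f F1 P != 0)].

(* The coarse moduli space of [P^1/G], G finite, is the geometric quotient of
   P^1 by G. It is P^1 if there is a G-invariant morphism pi : P^1 -> P^1 that,
   on points over algebraically closed extensions, is surjective and has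
   the G-orbits as fibres, and such that O = (pi_* O)^G. (That pi is a
   topological quotient map is automatic, since pi is proper.) For the last
   condition, the open subsets of the target are the loci F <> 0 for binary
   forms F of some degree m; with F' the pull-back of F, which has degree d * m,
   the sections over the preimage are the fractions S / F'^n with S of degree
   d * m * n. Those that are G-invariant must be pull-backs of sections
   T / F^r; the converse is immediate. *)
Definition coarse_space_is_P1 (k : fieldType) : Prop :=
  exists (d : nat) (F0 F1 : {mpoly k[2]}),
    let pi (K : fieldType) (f : {rmorphism k -> K}) := map_P1 f F0 F1 in
    [/\ is_P1_morphism d F0 F1,
        forall (K : fieldType) (f : {rmorphism k -> K}) (P : P1 K) (g : gT),
          g \in G -> pi K f (act P g) = pi K f P,
        forall (K : closedFieldType) (f : {rmorphism k -> K}) (Q : P1 K),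
          exists P, pi K f P = Q,
        forall (K : closedFieldType) (f : {rmorphism k -> K}) (P Q : P1 K),
          pi K f P = pi K f Q -> same_orbit P Q
      & forall (m n : nat) (F S : {mpoly k[2]}),
          F \is m.-homog -> S \is (d * m * n).-homog ->
          let F' := F \mPo [tuple F0; F1] in
          (forall (K : fieldType) (f : {rmorphism k -> K}) (P : P1 K) (g : gT),
             g \in G -> form_at f F' P != 0 ->
             form_at f S (act P g) / form_at f F' (act P g) ^+ n
               = form_at f S P / form_at f F' P ^+ n) ->
          exists (r : nat) (T : {mpoly k[2]}), T \is (m * r).-homog /\
            forall (K : fieldType) (f : {rmorphism k -> K}) (P : P1 K),
              form_at f F' P != 0 ->
              form_at f S P / form_at f F' P ^+ n
                = form_at f T (pi K f P) / form_at f F (pi K f P) ^+ r].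

End Orbifold.

(* Main.v *)
Require Import Defs.
From HB Require Import structures.
From mathcomp Require Import all_boot all_order all_fingroup all_algebra.
From mathcomp Require Import all_solvable fraction.
From mathcomp Require Import mpoly ring zify.

(* S_4 acts on P^1 through S_4 / V_4 = S_3, the anharmonic group, which also is
   the group of permutations of the three points of P^1 over the field with two
   elements. Hence R(Gam) acts as one of the six subgroups of the anharmonic
   group.

   For each of them a pair (F0 : F1) of invariant binary forms of degree |R|
   defines the quotient map; the cross difference F0(P) F1(Q) - F1(P) F0(Q)
   factors over the group, so the fibres are the orbits. An invariant form S of
   degree |R| N is a form in F0 and F1, by induction on N: subtract a multiple
   of F0^N to make it vanish on an orbit contained in {0, 1, oo}, then divide
   by F1.

   A point with a nontrivial stabilizer in the anharmonic group is one of 0, 1,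
   oo, -1, 1/2, 2 and the two roots of x^2 - x + 1. These eight points are
   distinct because 6 is invertible, and the group permutes them by a fixed
   table, from which the orders are read off. *)

Set Implicit Arguments.
Unset Strict Implicit.
Unset Printing Implicit Defensive.

Import GroupScope GRing.Theory.
Local Open Scope ring_scope.

(** * The anharmonic group *)

(* The anharmonic group: x, 1/x, 1-x, x/(x-1), 1/(1-x), (x-1)/x. *)
Inductive anh := Aid | At1 | At2 | At3 | Ar1 | Ar2.

(* The scalars are chosen so that the forms defining the quotient maps are
   invariant, not just semi-invariant. *)
Definition anh_lin (a : anh) (R : comNzRingType) (u v : R) : R * R :=
  match a with
  | Aid => (u, v)
  | At1 => (v, u)
  | At2 => (v - u, v)
  | At3 => (u, u - v)
  | Ar1 => (- v, u - v)
  | Ar2 => (v - u, - u)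
  end.

Definition anh_act (a : anh) (K : fieldType) (P : P1 K) : P1 K :=
  let w := anh_lin a (hcoord P ord0) (hcoord P ord_max) in of_hcoord w.1 w.2.

Lemma of_hcoordN (K : fieldType) (x y : K) : of_hcoord (- x) (- y) = of_hcoord x y.
Proof. by rewrite -(mulN1r x) -(mulN1r y) of_hcoordZ // oppr_eq0 oner_eq0. Qed.

Lemma std_configE (K : fieldType) (P : P1 K) :
  (std_config P (i4 0) = P) * (std_config P (i4 1) = Some 1) *
  (std_config P (i4 2) = Some 0) * (std_config P (i4 3) = None).
Proof. by rewrite /std_config /i4 !(tnth_nth None) !inordK. Qed.

Lemma i4_cases (i : 'I_4) : [\/ i = i4 0, i = i4 1, i = i4 2 | i = i4 3].
Proof. by move: i; apply: ord4P; [exact: Or41|exact: Or42|exact: Or43|exact: Or44]. Qed.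

Lemma bracketE (K : fieldType) (P : P1 K) : let u := hcoord P ord0 in
  let v := hcoord P ord_max in
  (bracket P (Some 0) = u) * (bracket P (Some 1) = u - v) * (bracket P None = - v) *
  (bracket (Some 0) P = - u) * (bracket (Some 1) P = v - u) * (bracket None P = v).
Proof.
by do 5?split; rewrite /bracket /= ?mulr1 ?mulr0 ?mul1r ?mul0r ?subr0 ?sub0r.
Qed.

Lemma bracket_const (K : fieldType) :
  (@bracket K (Some 1) (Some 0) = 1) * (@bracket K (Some 1) None = - 1) *
  (@bracket K (Some 0) None = - 1) * (@bracket K (Some 0) (Some 1) = - 1) *
  (@bracket K None (Some 1) = 1) * (@bracket K None (Some 0) = 1).
Proof. by rewrite !bracketE /= subr0 sub0r. Qed.

(** Every coset of [V4] in S_4 thus contains a permutation fixing the index 3, so only the six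
    permutations of 0, 1, 2 need a cross-ratio computation. *)
Lemma V4_transitive (i : 'I_4) : exists2 v : 'S_4, v \in V4 & v i = i4 3.
Proof.
move: i; apply: ord4P.
- exists (tperm (i4 0) (i4 3) * tperm (i4 1) (i4 2))%g; first by rewrite !inE eqxx !orbT.
  by rewrite permM tpermL tpermD // i4_eq.
- exists (tperm (i4 0) (i4 2) * tperm (i4 1) (i4 3))%g; first by rewrite !inE eqxx !orbT.
  by rewrite permM (@tpermD _ (i4 0) (i4 2)) ?i4_eq // tpermL.
- exists (tperm (i4 0) (i4 1) * tperm (i4 2) (i4 3))%g; first by rewrite !inE eqxx !orbT.
  by rewrite permM (@tpermD _ (i4 0) (i4 1)) ?i4_eq // tpermL.
- by exists 1%g; rewrite ?perm1 // !inE eqxx.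
Qed.

(** The element [a] is chosen before the field, so that a computation over one field determines it
    for all. The second clause yields the kernel of the action. *)
Lemma m04_act_anh (s : 'S_4) :
  exists a : anh, (forall (K : fieldType) (P : P1 K), m04_act P s = anh_act a P) /\
    (a = Aid -> s \in V4).
Proof.
have [v vV v3] := V4_transitive (s (i4 3)).
pose t := (s * v)%g.
have tE K (P : P1 K) : m04_act P s = m04_act P t by rewrite m04_actM (m04_act_V4 _ vV).
have e3 : (t^-1)%g (i4 3) = i4 3.
  by apply: (@perm_inj _ t); rewrite permKV permM v3.
have n (i j : nat) : (i < 4)%N -> (j < 4)%N -> i != j ->
    (t^-1)%g (i4 i) != (t^-1)%g (i4 j).
  by move=> li lj; rewrite (inj_eq perm_inj) i4_eq.
have [n01 n02] : (t^-1)%g (i4 0) != (t^-1)%g (i4 1) /\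
   (t^-1)%g (i4 0) != (t^-1)%g (i4 2) by split; apply: n.
have [n12 n03] : (t^-1)%g (i4 1) != (t^-1)%g (i4 2) /\
  (t^-1)%g (i4 0) != (t^-1)%g (i4 3) by split; apply: n.
have [n13 n23] : (t^-1)%g (i4 1) != (t^-1)%g (i4 3) /\
  (t^-1)%g (i4 2) != (t^-1)%g (i4 3) by split; apply: n.
(* Injectivity leaves six of the 64 cases, in lexicographic order of the images of 0, 1, 2 under the
   inverse of [t]; the witnesses below follow that order. *)
case: (i4_cases ((t^-1)%g (i4 0))) => e0;
case: (i4_cases ((t^-1)%g (i4 1))) => e1;
case: (i4_cases ((t^-1)%g (i4 2))) => e2;
rewrite ?e0 ?e1 ?e2 ?e3 ?i4_eq // in n01 n02 n03 n12 n13 n23.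
all: clear n n01 n02 n03 n12 n13 n23.
1: exists Aid.
2: exists At2.
3: exists At1.
4: exists Ar2.
5: exists Ar1.
6: exists At3.
all: split=> [K P|//].
all: try rewrite tE /m04_act /cross_ratio /anh_act e0 e1 e2 e3 !std_configE /=
  ?(bracketE P) ?bracket_const.
all: try by [congr of_hcoord; ring | rewrite -of_hcoordN; congr of_hcoord; ring].
move=> _; suff t1 : t = 1%g by rewrite -(mulgK v s) -/t t1 mul1g groupV.
by apply/invg_inj/permP; apply: ord4P; rewrite invg1 perm1.
Qed.

Definition anh_code (a : anh) : nat :=
  match a with Aid => 0 | At1 => 1 | At2 => 2 | At3 => 3 | Ar1 => 4 | Ar2 => 5 end.
Definition anh_decode (n : nat) : anh := nth Aid [:: Aid; At1; At2; At3; Ar1; Ar2] n.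
Lemma anh_codeK : cancel anh_code anh_decode. Proof. by case. Qed.
HB.instance Definition _ := Equality.copy anh (can_type anh_codeK).

(* The points 0, 1, oo have the indices 0, 1, 2. *)
Definition anh_images (a : anh) : seq nat :=
  match a with
  | Aid => [:: 0; 1; 2] | At1 => [:: 2; 1; 0] | At2 => [:: 1; 0; 2]
  | At3 => [:: 0; 2; 1] | Ar1 => [:: 1; 2; 0] | Ar2 => [:: 2; 0; 1]
  end%N.

Lemma ord3P (Q : 'I_3 -> Prop) :
  Q (inZp 0) -> Q (inZp 1) -> Q (inZp 2) -> forall i, Q i.
Proof.
move=> q0 q1 q2 [[|[|[|//]]] lt].
- by rewrite (_ : Ordinal lt = inZp 0) //; apply: val_inj.
- by rewrite (_ : Ordinal lt = inZp 1) //; apply: val_inj.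
- by rewrite (_ : Ordinal lt = inZp 2) //; apply: val_inj.
Qed.

Definition anh_fun (a : anh) (i : 'I_3) : 'I_3 := inZp (nth 0%N (anh_images a) i).

Lemma anh_fun_inj a : injective (anh_fun a).
Proof.
by case: a; apply: ord3P; apply: ord3P => //= /(congr1 val).
Qed.

Definition anh_perm (a : anh) : 'S_3 := perm (@anh_fun_inj a).

(** The images of 0 and 1 determine the third, so each wildcard branch is met by exactly one
    permutation. *)
Definition anh_of (p : 'S_3) : anh :=
  match val (p (inZp 0)), val (p (inZp 1)) with
  | 0, 1 => Aid | 0, _ => At3 | 1, 0 => At2 | 1, _ => Ar1 | _, 1 => At1 | _, _ => Ar2
  end%N.

Lemma anh_permK : cancel anh_perm anh_of.
Proof. by case; rewrite /anh_of !permE. Qed.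

Lemma anh_of_inj : injective anh_of.
Proof.
move=> p q; rewrite /anh_of => E.
have [] : val (p (inZp 0)) != val (p (inZp 1)) /\ val (q (inZp 0)) != val (q (inZp 1)).
  by rewrite !val_eqE !(inj_eq perm_inj).
have [] : val (p (inZp 0)) != val (p (inZp 2)) /\ val (q (inZp 0)) != val (q (inZp 2)).
  by rewrite !val_eqE !(inj_eq perm_inj).
have [] : val (p (inZp 1)) != val (p (inZp 2)) /\ val (q (inZp 1)) != val (q (inZp 2)).
  by rewrite !val_eqE !(inj_eq perm_inj).
suff H : [/\ p (inZp 0) = q (inZp 0), p (inZp 1) = q (inZp 1) & p (inZp 2) = q (inZp 2)] ->
  p = q.
  move=> n1 n2 n3 n4 n5 n6; apply: H; move: E n1 n2 n3 n4 n5 n6.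
  move: (p _) (p _) (p _) (q _) (q _) (q _).
  by do 6!(apply: ord3P => //=); split.
by case=> e0 e1 e2; apply/permP; apply: ord3P.
Qed.

Lemma anh_ofK : cancel anh_of anh_perm.
Proof. by move=> p; apply: anh_of_inj; rewrite anh_permK. Qed.

(** Over the field with two elements the three boundary points are the whole projective line, so
    [m04_act] itself supplies a map to ['S_3], multiplicative by [m04_actM]. *)
Definition bd (i : 'I_3) : P1 'F_2 := nth None [:: Some 0; Some 1; None] i.
Definition bd_inv (P : P1 'F_2) : 'I_3 :=
  if P is Some x then if x == 0 then inZp 0 else inZp 1 else inZp 2.

Lemma bd_invK : cancel bd_inv bd.
Proof. by case=> [[[|[|//]] lt]|] //=; congr Some; apply: val_inj. Qed.

Lemma bd_perm_inj (s : 'S_4) : injective (fun i => bd_inv (m04_act (bd i) s)).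
Proof.
apply: (can_inj (g := fun i => bd_inv (m04_act (bd i) s^-1%g))) => i.
by rewrite bd_invK -m04_actM mulgV m04_act1; move: i; apply: ord3P; apply: val_inj.
Qed.

Definition bd_perm (s : 'S_4) : 'S_3 := perm (@bd_perm_inj s).

Lemma bd_permM : {morph bd_perm : s t / (s * t)%g}.
Proof.
by move=> s t; apply/permP => i; rewrite permM !permE bd_invK m04_actM.
Qed.

(** The six transformations permute the three points over the field with two elements in different
    ways, which identifies the [a] of [m04_act_anh]; the conclusion then holds over every [K]. *)
Lemma bd_permP (s : 'S_4) :
  (forall (K : fieldType) (P : P1 K), m04_act P s = anh_act (anh_of (bd_perm s)) P) /\
  (bd_perm s = 1%g -> s \in V4).
Proof.
have [a [aE aV]] := m04_act_anh s.
have E : bd_perm s = anh_perm a.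
  apply/permP => i; rewrite !permE aE.
  by case: (a); move: i; apply: ord3P; apply: val_inj; vm_compute.
rewrite E anh_permK; split=> // a1; apply: aV; apply: (can_inj anh_permK).
rewrite a1; apply/permP => i; rewrite perm1 permE.
by move: i; apply: ord3P; apply: val_inj.
Qed.

(** The factors act from left to right, as for permutations. *)
Definition anh_mul (a b : anh) : anh :=
  match a, b with
  | Aid, c | c, Aid => c
  | At1, At1 | At2, At2 | At3, At3 | Ar1, Ar2 | Ar2, Ar1 => Aid
  | At1, At2 | At2, At3 | At3, At1 | Ar1, Ar1 => Ar2
  | At2, At1 | At3, At2 | At1, At3 | Ar2, Ar2 => Ar1
  | At2, Ar1 | At3, Ar2 | Ar1, At3 | Ar2, At2 => At1
  | At3, Ar1 | At1, Ar2 | Ar1, At1 | Ar2, At3 => At2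
  | At1, Ar1 | At2, Ar2 | Ar1, At2 | Ar2, At1 => At3
  end.

Lemma anh_permM (a b : anh) : (anh_perm a * anh_perm b)%g = anh_perm (anh_mul a b).
Proof.
by apply/permP; case: a; case: b; apply: ord3P; rewrite permM !permE; apply: val_inj.
Qed.

Definition anh_subgroups : seq (seq anh) :=
  [:: [:: Aid]; [:: Aid; At1]; [:: Aid; At2]; [:: Aid; At3]; [:: Aid; Ar1; Ar2];
      [:: Aid; At1; At2; At3; Ar1; Ar2]].

Lemma anh_subgroupP (D : {group 'S_3}) :
  exists2 L, L \in anh_subgroups & perm_eq [seq anh_of p | p <- enum D] L.
Proof.
pose m a := anh_perm a \in D.
have mM a b : m a && m b ==> m (anh_mul a b).
  by apply/implyP => /andP[]; rewrite /m -anh_permM; apply: groupM.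
have m1 : m Aid.
  suff -> : Aid = anh_of 1 by rewrite /m anh_ofK group1.
  by rewrite /anh_of !perm1.
have mE a : (a \in [seq anh_of p | p <- enum D]) = m a.
  by rewrite -[a]anh_permK (mem_map anh_of_inj) mem_enum /m anh_permK.
suff [L LS [uL LE]] : exists2 L, L \in anh_subgroups & uniq L /\ forall a, (a \in L) = m a.
  exists L => //; apply: uniq_perm => // [|a]; last by rewrite mE LE.
  by rewrite (map_inj_uniq anh_of_inj) enum_uniq.
(* Closure under eleven products rules out all but six of the 32 membership patterns of the
   non-identity elements. *)
have := (mM At1 At2, mM At2 At3, mM At1 At3, mM Ar1 Ar1, mM Ar2 Ar2).
have := (mM At1 Ar1, mM At1 Ar2, mM At2 Ar1, mM At2 Ar2, mM At3 Ar1, mM At3 Ar2).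
rewrite /=.
case e1: (m At1); case e2: (m At2); case e3: (m At3); case e4: (m Ar1); case e5: (m Ar2);
  case=> [[[[[h1 h2] h3] h4] h5] h6] [[[[h7 h8] h9] h10] h11] //.
all: let go L := (exists L; [by [] | split=> //; case; by rewrite !inE ?e1 ?e2 ?e3 ?e4 ?e5 ?m1]) in
  first [go [:: Aid] | go [:: Aid; At1] | go [:: Aid; At2] | go [:: Aid; At3]
       | go [:: Aid; Ar1; Ar2] | go [:: Aid; At1; At2; At3; Ar1; Ar2]].
Qed.

(** * The action of R(Gam) through a subgroup of S_3 *)

Section RgroupAction.
Variables (Gam : wgraph) (v0 : vertex Gam) (e : 4.-tuple (halfedge Gam)).
Hypothesis labelling : perm_eq e (enum (star v0)).
Hypothesis uniq4 : forall v : vertex Gam, vdeg v = 4%N -> v = v0.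

Definition Rperm (c : coset_of (sigma_preim_V4 e)) : 'S_3 := bd_perm (sigma e (repr c)).

Lemma R_actE (K : fieldType) (P : P1 K) (c : coset_of (sigma_preim_V4 e)) :
  R_act P c = anh_act (anh_of (Rperm c)) P.
Proof. exact: (bd_permP _).1. Qed.

(** This is the first isomorphism theorem for [bd_perm] after [sigma]: by [bd_permP] and the
    triviality of the action of [V4], its kernel is the preimage of [V4]. *)
Lemma Rgroup_perm : exists D : {group 'S_3},
  [/\ Rgroup e \isog D, {in Rgroup e &, injective Rperm} & Rperm @: Rgroup e = D].
Proof.
pose K4 := Group (sigma_preim_V4_group_set labelling uniq4).
pose G := graph_aut_group Gam.
have psiM : {in G &, {morph (fun a => bd_perm (sigma e a)) : a b / (a * b)%g}}.
  by move=> a b aG bG /=; rewrite (sigmaM labelling uniq4) // bd_permM.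
pose psi := Morphism psiM.
have kerE : 'ker psi = K4.
  apply/setP => a; apply/morphpreP/setIdP => -[aG].
    by move/set1P => a1; split=> //; apply: (bd_permP _).2.
  move=> aV; split=> //; apply/set1P.
  apply: anh_of_inj; rewrite -[RHS](_ : Aid = _); last by rewrite /anh_of !perm1.
  apply: (can_inj anh_permK); apply/permP => i; rewrite anh_ofK !permE.
  by rewrite (m04_act_V4 _ aV); move: i; apply: ord3P; apply: val_inj.
have RpermE a : a \in G -> Rperm (coset K4 a) = bd_perm (sigma e a).
  move=> aG; have aN : (a \in 'N(K4))%g.
    exact: (subsetP (normal_norm (sigma_preim_V4_normal labelling uniq4))).
  have : repr (coset K4 a) \in coset K4 a by rewrite mem_repr_coset.
  rewrite /Rperm {2}(val_coset aN) => /rcosetP[b bK ->].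
  have bk : b \in 'ker psi by rewrite kerE.
  have bG : b \in G by move: bk => /morphpreP[].
  by rewrite (psiM b a) // (mker bk : bd_perm _ = _) mul1g.
have isoD : Rgroup e \isog (psi @* G)%G.
  by have := first_isog psi; rewrite kerE.
have imE : Rperm @: Rgroup e = psi @* G.
  apply/setP => p; apply/imsetP/morphimP => [[_ /morphimP[a _ aG ->] ->]|[a _ aG ->]].
    by exists a => //; rewrite /= RpermE.
  exists (coset K4 a); last by rewrite RpermE.
  exact: (mem_quotient K4 aG).
exists (psi @* G)%G; split=> //.
(* A map is injective on a finite set when its image has as many elements. *)
by apply/imset_injP; rewrite imE (card_isog isoD).
Qed.

End RgroupAction.

(** Orbits and stabilizer orders depend only on the transformations that occur, listed with
    multiplicity. One [phi] serves all fields, as the coarse space is tested on all extensions of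
    the base. *)
Definition acts_by (gT : finGroupType) (G : {set gT})
    (act : forall K : fieldType, P1 K -> gT -> P1 K) (L : seq anh) : Prop :=
  exists2 phi : gT -> anh, perm_eq [seq phi g | g <- enum G] L &
    forall (K : fieldType) (P : P1 K) g, act K P g = anh_act (phi g) P.

Lemma Rgroup_acts_by (Gam : wgraph) (v0 : vertex Gam) (e : 4.-tuple (halfedge Gam)) :
  perm_eq e (enum (star v0)) -> (forall v : vertex Gam, vdeg v = 4%N -> v = v0) ->
  exists2 D : {group 'S_3}, Rgroup e \isog D &
  exists2 L, L \in anh_subgroups & size L = #|D| /\ acts_by (Rgroup e) (@R_act Gam e) L.
Proof.
move=> lab u; have [D [isoD inj im]] := Rgroup_perm lab u.
exists D => //; have [L LS pL] := anh_subgroupP D; exists L => //; split.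
  by rewrite -(perm_size pL) size_map cardE.
exists (anh_of \o @Rperm _ e) => [|K P g]; last exact: R_actE.
apply: perm_trans pL; rewrite (map_comp anh_of (@Rperm _ e)). apply: perm_map.
have U : uniq [seq Rperm i | i <- enum (Rgroup e)].
  by rewrite map_inj_in_uniq ?enum_uniq // => x y; rewrite !mem_enum; apply: inj.
apply: (uniq_perm U (enum_uniq _)) => p.
rewrite mem_enum -im; apply/mapP/imsetP => -[c cR ->]; exists c => //.
  by rewrite mem_enum in cR.
by rewrite mem_enum.
Qed.

(** * Binary forms and quotient maps *)

Definition pt (R : Type) (u v : R) : 'I_2 -> R := fun i => if i == ord0 then u else v.

Section Evaluation.
Variables (k : fieldType) (R : comNzRingType) (f : {rmorphism k -> R}).

(** Values in an arbitrary commutative ring allow polynomials to be substituted for the coordinates,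
    as in [uni] and [inv_poly]. *)
Definition ev (S : {mpoly k[2]}) (u v : R) : R := mmap f (pt u v) S.

Lemma evM S T u v : ev (S * T) u v = ev S u v * ev T u v.
Proof. exact: rmorphM. Qed.

Lemma evN S u v : ev (- S) u v = - ev S u v.
Proof. exact: rmorphN. Qed.

Lemma evD S T u v : ev (S + T) u v = ev S u v + ev T u v.
Proof. exact: rmorphD. Qed.

Lemma evXn S n u v : ev (S ^+ n) u v = ev S u v ^+ n.
Proof. exact: rmorphXn. Qed.

Lemma evMn S n u v : ev (S *+ n) u v = ev S u v *+ n.
Proof. exact: rmorphMn. Qed.

Lemma ev0 u v : ev 'X_ord0 u v = u.
Proof. by rewrite /ev mmapX mmap1U. Qed.

Lemma ev1 u v : ev 'X_ord_max u v = v.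
Proof. by rewrite /ev mmapX mmap1U. Qed.

Lemma evZ c S u v : ev (c *: S) u v = f c * ev S u v.
Proof. by rewrite /ev mmapZ. Qed.

Lemma ev_sum I (r : seq I) (P : pred I) (F : I -> {mpoly k[2]}) u v :
  ev (\sum_(i <- r | P i) F i) u v = \sum_(i <- r | P i) ev (F i) u v.
Proof. exact: (raddf_sum (mmap f (pt u v))). Qed.

Definition evE := (evM, evN, evD, evXn, evMn, ev0, ev1).

(** The homogenization of [p] in degree [D], evaluated at (u, v). Coefficients beyond [D] are
    dropped, whence the size bounds in what follows. *)
Definition hev (D : nat) (p : {poly k}) (u v : R) : R :=
  \sum_(i < D.+1) f p`_i * (u ^+ i * v ^+ (D - i)).

Lemma hev_sum D I (r : seq I) (P : pred I) (F : I -> {poly k}) u v :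
  hev D (\sum_(i <- r | P i) F i) u v = \sum_(i <- r | P i) hev D (F i) u v.
Proof.
rewrite /hev exchange_big /=; apply: eq_bigr => i _.
by rewrite coef_sum rmorph_sum mulr_suml; apply: eq_bigr.
Qed.

Lemma hevZ D c p u v : hev D (c *: p) u v = f c * hev D p u v.
Proof. by rewrite /hev mulr_sumr; apply: eq_bigr => i _; rewrite coefZ rmorphM -mulrA. Qed.

Lemma hevB D (p q : {poly k}) u v : hev D (p - q) u v = hev D p u v - hev D q u v.
Proof.
by rewrite /hev -sumrB; apply: eq_bigr => i _; rewrite coefB rmorphB mulrBl.
Qed.

Lemma hevXn D i u v : (i <= D)%N -> hev D 'X^i u v = u ^+ i * v ^+ (D - i).
Proof.
move=> iD; rewrite /hev (bigD1 (Ordinal (iD : (i < D.+1)%N))) //= coefXn eqxx rmorph1 mul1r.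
rewrite big1 ?addr0 // => j ji; rewrite coefXn.
by rewrite (_ : (j == i :> nat) = false) ?rmorph0 ?mul0r //; apply: negbTE.
Qed.

Lemma poly_sum_le D (p : {poly k}) : (size p <= D.+1)%N -> p = \sum_(i < D.+1) p`_i *: 'X^i.
Proof.
by move=> sp; rewrite -[LHS]coefK poly_def (big_ord_widen _ (fun i => p`_i *: 'X^i) sp) 
 big_mkcond; apply: eq_bigr => i _; case: ltnP => // h; rewrite nth_default // scale0r.
Qed.

Lemma hevM D E (p q : {poly k}) u v : (size p <= D.+1)%N -> (size q <= E.+1)%N ->
  hev (D + E) (p * q) u v = hev D p u v * hev E q u v.
Proof.
move=> sp sq; rewrite [p in LHS](poly_sum_le sp) [q in LHS](poly_sum_le sq).
rewrite mulr_suml hev_sum [hev D p u v]/hev mulr_suml; apply: eq_bigr => i _.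
rewrite mulr_sumr hev_sum [hev E q u v]/hev mulr_sumr; apply: eq_bigr => j _.
have [iD jE] : (i <= D /\ j <= E)%N by rewrite -ltnS ltn_ord -ltnS ltn_ord.
rewrite -scalerAl -scalerAr -exprD !hevZ hevXn ?leq_add //.
rewrite exprD (_ : D + E - (i + j) = (D - i) + (E - j))%N ?exprD; first by ring.
by lia.
Qed.

Lemma hev_infty D (p : {poly k}) : hev D p 1 0 = f p`_D.
Proof.
rewrite /hev big_ord_recr /= subnn expr0 expr1n !mulr1 big1 ?add0r // => i _.
by rewrite expr0n subn_eq0 leqNgt ltn_ord !mulr0.
Qed.

Lemma hev_affine D (p : {poly k}) u : (size p <= D.+1)%N ->
  hev D p u 1 = (map_poly f p).[u].
Proof.
move=> sp; rewrite (@horner_coef_wide _ D.+1); last first.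
  by apply: leq_trans sp; apply: size_poly.
by apply: eq_bigr => i _; rewrite coef_map expr1n mulr1.
Qed.

Lemma hevX D (p : {poly k}) n u v : (size p <= D.+1)%N ->
  hev (D * n) (p ^+ n) u v = hev D p u v ^+ n.
Proof.
move=> sp; elim: n => [|n IH].
  by rewrite muln0 !expr0 /hev big_ord1 coef1 rmorph1 !mul1r.
rewrite mulnS !exprS hevM // ?IH //.
apply: leq_trans (size_poly_exp_leq _ _) _.
by rewrite ltnS leq_mul2r; apply/orP; right; lia.
Qed.

End Evaluation.

Definition uni (k : fieldType) (S : {mpoly k[2]}) : {poly k} := ev polyC S 'X 1.

Section Homogeneous.
Variable k : fieldType.

Lemma mdeg2 (m : 'X_{1..2}) : mdeg m = (m ord0 + m ord_max)%N.
Proof. by rewrite mdegE big_ord_recl big_ord1; congr (_ + m _)%N; apply: val_inj. Qed.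

Lemma mmap1_pt (R : comNzRingType) (u v : R) (m : 'X_{1..2}) :
  mmap1 (pt u v) m = u ^+ m ord0 * v ^+ m ord_max.
Proof.
rewrite /mmap1 big_ord_recl big_ord1 /pt /=; congr (_ * v ^+ m _); exact: val_inj.
Qed.

Variables (D : nat) (S : {mpoly k[2]}).
Hypothesis homS : S \is D.-homog.

Lemma homog_mdeg m : m \in msupp S -> (m ord0 + m ord_max)%N = D.
Proof. by move=> mS; rewrite -mdeg2; apply: (dhomog_mf homS mS). Qed.

Lemma uniE : uni S = \sum_(m <- msupp S) S@_m *: 'X^(m ord0).
Proof.
rewrite /uni /ev /mmap; apply: eq_bigr => m _.
by rewrite mmap1_pt expr1n mulr1 mul_polyC.
Qed.

(** Forms can thus be replaced by univariate polynomials, for which roots and division are at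
    hand. *)
Lemma ev_hev (R : comNzRingType) (f : {rmorphism k -> R}) (u v : R) :
  ev f S u v = hev f D (uni S) u v.
Proof.
rewrite uniE hev_sum /ev /mmap !big_seq; apply: eq_bigr => m mS.
have mD := homog_mdeg mS.
by rewrite hevZ hevXn -?mD ?leq_addr // addKn mmap1_pt.
Qed.

Lemma size_uni : (size (uni S) <= D.+1)%N.
Proof.
rewrite uniE; apply: leq_trans (size_sum _ _ _) _; rewrite big_seq.
apply/bigmax_leqP_seq => m mS _; apply: leq_trans (size_scale_leq _ _) _.
rewrite size_polyXn ltnS -(homog_mdeg mS).
exact: leq_addr.
Qed.

Lemma evZZ (R : comNzRingType) (f : {rmorphism k -> R}) (c u v : R) :
  ev f S (c * u) (c * v) = c ^+ D * ev f S u v.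
Proof.
rewrite !ev_hev /hev mulr_sumr; apply: eq_bigr => i _.
rewrite !exprMn mulrACA -exprD subnKC; last by rewrite -ltnS.
exact: mulrCA.
Qed.

End Homogeneous.

Lemma form_atE (k K : fieldType) (f : {rmorphism k -> K}) (F : {mpoly k[2]}) (P : P1 K) :
  form_at f F P = ev f F (hcoord P ord0) (hcoord P ord_max).
Proof.
rewrite /form_at /ev /map_mpoly /mmap rmorph_sum; apply: eq_bigr => m _ /=.
rewrite mevalM mevalC; congr (_ * _).
rewrite /mmap1 !big_ord_recl !big_ord0 !mulr1 mevalM !rmorphXn /= !mevalXU /pt.
rewrite /= (_ : lift ord0 ord0 = ord_max :> 'I_2) //.
exact: val_inj.
Qed.

Lemma ev_comp (k : fieldType) (R : comNzRingType) (f : {rmorphism k -> R})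
    (F F0 F1 : {mpoly k[2]}) (u v : R) :
  ev f (F \mPo [tuple F0; F1]) u v = ev f F (ev f F0 u v) (ev f F1 u v).
Proof.
rewrite comp_mpolyEX ev_sum [RHS]/ev [RHS]/mmap; apply: eq_bigr => m _.
rewrite evZ mmap1_pt comp_mpolyX big_ord_recl big_ord1 evM !evXn /=.
by congr (_ * (_ * _ ^+ m _)); apply: val_inj.
Qed.

Lemma ev_rmorph (k : fieldType) (R R' : comNzRingType) (f : {rmorphism k -> R})
    (g : {rmorphism R -> R'}) (S : {mpoly k[2]}) (u v : R) :
  g (ev f S u v) = ev (g \o f) S (g u) (g v).
Proof.
rewrite /ev /mmap rmorph_sum; apply: eq_bigr => m _.
by rewrite rmorphM !mmap1_pt rmorphM !rmorphXn.
Qed.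

Section HomogeneousCoordinates.
Variable K : fieldType.
Implicit Types (P Q : P1 K) (x y : K).

Lemma hcoord_neq0 P : (hcoord P ord0 != 0) || (hcoord P ord_max != 0).
Proof. by case: P => [a|] /=; rewrite oner_eq0 ?orbT. Qed.

Lemma of_hcoordK P : of_hcoord (hcoord P ord0) (hcoord P ord_max) = P.
Proof. by case: P => [a|]; rewrite /of_hcoord /= ?oner_eq0 ?eqxx // divr1. Qed.

Lemma hcoord_of x y : (x != 0) || (y != 0) -> exists2 c, c != 0 &
  hcoord (of_hcoord x y) ord0 = c * x /\ hcoord (of_hcoord x y) ord_max = c * y.
Proof.
rewrite /of_hcoord; have [-> |y0 _] := eqVneq y 0.
  by rewrite orbF => x0; exists x^-1; rewrite ?invr_eq0 //= mulVf ?mulr0.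
by exists y^-1; rewrite ?invr_eq0 //= mulVf // mulrC.
Qed.

Lemma of_hcoord_eq x y P : (x != 0) || (y != 0) ->
  (of_hcoord x y == P) = (x * hcoord P ord_max == y * hcoord P ord0).
Proof.
move=> nz; rewrite -bracket_eq0 /bracket; have [c c0 [-> ->]] := hcoord_of nz.
rewrite [X in X == 0](_ : _ = c * (x * hcoord P ord_max - y * hcoord P ord0)); last by ring.
by rewrite mulf_eq0 (negPf c0) subr_eq0.
Qed.

Lemma anh_lin_neq0 a x y : (x != 0) || (y != 0) ->
  ((anh_lin a x y).1 != 0) || ((anh_lin a x y).2 != 0).
Proof.
apply: contraLR; rewrite !negb_or !negbK => /andP[].
case: a => /=; rewrite ?oppr_eq0 ?subr_eq0.
- by move=> -> ->.
- by move=> -> ->.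
- by move=> /eqP <- ->.
- by move=> /eqP ->; rewrite eq_sym => ->; rewrite eqxx.
- by move=> /eqP -> ->; rewrite eqxx.
- by move=> /eqP -> ->.
Qed.

Lemma anh_act_eq a P Q : (anh_act a P == Q) =
  ((anh_lin a (hcoord P ord0) (hcoord P ord_max)).1 * hcoord Q ord_max ==
   (anh_lin a (hcoord P ord0) (hcoord P ord_max)).2 * hcoord Q ord0).
Proof. by rewrite /anh_act of_hcoord_eq // anh_lin_neq0 // hcoord_neq0. Qed.

End HomogeneousCoordinates.

Lemma rmorph_anh_lin (R R' : comNzRingType) (g : {rmorphism R -> R'}) a u v :
  (g (anh_lin a u v).1 = (anh_lin a (g u) (g v)).1) *
  (g (anh_lin a u v).2 = (anh_lin a (g u) (g v)).2).
Proof. by case: a; rewrite /= ?rmorphB ?rmorphN. Qed.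

(** A fraction of degree 0 does not depend on the choice of homogeneous coordinates. *)
Lemma fraction_scale (K : fieldType) (c x y : K) (m n : nat) : c != 0 ->
  c ^+ (m * n) * x / (c ^+ m * y) ^+ n = x / y ^+ n.
Proof.
by move=> c0; rewrite exprMn -exprM invfM mulrACA divff ?expf_neq0 // mul1r.
Qed.

(** * The coarse space from two invariant forms *)

Section Coarse.
Variables (k : fieldType) (L : seq anh) (d : nat) (F0 F1 : {mpoly k[2]}).
Hypotheses (d_gt0 : (0 < d)%N) (hom0 : F0 \is d.-homog) (hom1 : F1 \is d.-homog).

Definition inv_form (F : {mpoly k[2]}) := forall a, a \in L ->
  forall (R : comNzRingType) (f : {rmorphism k -> R}) (u v : R),
    ev f F (anh_lin a u v).1 (anh_lin a u v).2 = ev f F u v.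

Hypotheses (inv0 : inv_form F0) (inv1 : inv_form F1).

(** Invariance of the homogenization in degree [D], tested at the generic point (X, 1) with values
    in k[X]. *)
Definition inv_poly (D : nat) (p : {poly k}) : Prop := (size p <= D.+1)%N /\
  forall a, a \in L -> hev polyC D p (anh_lin a 'X 1).1 (anh_lin a 'X 1).2 = p.

Lemma generated_forms (x0 : k) : (uni F0).[x0] != 0 -> uni F1 != 0 ->
  (forall N q, inv_poly (d * N.+1) q -> q.[x0] = 0 ->
     exists2 q' : {poly k}, (size q' <= (d * N).+1)%N & q = uni F1 * q') ->
  forall N p, inv_poly (d * N) p -> exists c : nat -> k,
     p = \sum_(i < N.+1) c i *: (uni F0 ^+ i * uni F1 ^+ (N - i)).
Proof.
move=> f0x f1 dvd; have H0 a : a \in L ->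
    hev polyC d (uni F0) (anh_lin a 'X 1).1 (anh_lin a 'X 1).2 = uni F0.
  by move=> aL; rewrite -ev_hev // inv0.
have H1 a : a \in L ->
    hev polyC d (uni F1) (anh_lin a 'X 1).1 (anh_lin a 'X 1).2 = uni F1.
  by move=> aL; rewrite -ev_hev // inv1.
have size0 := size_uni hom0; have size1 := size_uni hom1.
elim=> [|N IH] p [sp pinv].
  exists (fun => p`_0); rewrite big_ord1 !expr0 mulr1 alg_polyC.
  by apply: size1_polyC; move: sp; rewrite muln0.
pose c := p.[x0] / (uni F0).[x0] ^+ N.+1; pose q := p - c *: uni F0 ^+ N.+1.
have qinv : inv_poly (d * N.+1) q.
  split=> [|a aL]; last by rewrite hevB hevZ hevX // pinv // H0 // mul_polyC.
  rewrite (leq_trans (size_polyD _ _)) // geq_max sp size_polyN /=.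
  rewrite (leq_trans (size_scale_leq _ _)) // (leq_trans (size_poly_exp_leq _ _)) //.
  by rewrite ltnS leq_mul2r /= -subn1 leq_subLR add1n size0.
have qx : q.[x0] = 0.
  by rewrite hornerD hornerN hornerZ horner_exp /c divfK ?subrr // expf_neq0.
have [q' sq' qE] := dvd N q qinv qx.
(* The quotient [q'] is again invariant: the nonzero invariant factor [uni F1] cancels in k[X]. *)
have [|c' q'E] := IH q'.
  split=> // a aL; apply: (mulfI f1); rewrite -qE -{1}(H1 a aL) -hevM //.
  by rewrite -mulnS -qE; apply: qinv.2.
exists (fun i => if i == N.+1 then c else c' i).
rewrite big_ord_recr /= eqxx subnn expr0 mulr1 -[LHS](subrK (c *: uni F0 ^+ N.+1)).
congr (_ + _); rewrite -/q qE q'E mulr_sumr; apply: eq_bigr => i _.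
rewrite (ltn_eqF (ltn_ord i)) -scalerAr; congr (_ *: _).
by rewrite mulrCA -exprS subSn // -ltnS.
Qed.


Hypothesis nz : forall (K : fieldType) (f : {rmorphism k -> K}) (P : P1 K),
  (form_at f F0 P != 0) || (form_at f F1 P != 0).
Hypothesis fib : forall (K : fieldType) (f : {rmorphism k -> K}) (P Q : P1 K),
  form_at f F0 P * form_at f F1 Q = form_at f F1 P * form_at f F0 Q ->
  exists2 a, a \in L & anh_act a P = Q.
Hypothesis gen : forall N p, inv_poly (d * N) p -> exists c : nat -> k,
  p = \sum_(i < N.+1) c i *: (uni F0 ^+ i * uni F1 ^+ (N - i)).

Section Field.
Variables (K : fieldType) (f : {rmorphism k -> K}).

Lemma map_P1_eq (P Q : P1 K) : (map_P1 f F0 F1 P == Q) =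
  (form_at f F0 P * hcoord Q ord_max == form_at f F1 P * hcoord Q ord0).
Proof. by rewrite /map_P1 of_hcoord_eq // nz. Qed.

Lemma map_P1_act a (P : P1 K) : a \in L ->
  map_P1 f F0 F1 (anh_act a P) = map_P1 f F0 F1 P.
Proof.
move=> aL; rewrite /map_P1 !form_atE /anh_act.
have [c c0 [-> ->]] := hcoord_of (anh_lin_neq0 a (hcoord_neq0 P)).
by rewrite (evZZ hom0) (evZZ hom1) inv0 // inv1 // of_hcoordZ // expf_neq0.
Qed.

End Field.

(** The fibre over Q is the zero locus of a form of degree [d], dehomogenized to [W]. Either its top
    coefficient vanishes, and oo is a zero, or [W] has degree [d] > 0 and a root in the closed
    field. *)
Lemma map_P1_surj (K : closedFieldType) (f : {rmorphism k -> K}) (Q : P1 K) :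
  exists P, map_P1 f F0 F1 P = Q.
Proof.
pose W := hcoord Q ord_max *: map_poly f (uni F0) - hcoord Q ord0 *: map_poly f (uni F1).
have sizem F : F \is d.-homog -> (size (map_poly f (uni F)) <= d.+1)%N.
  by move=> hF; rewrite (leq_trans (size_poly _ _)) // size_uni.
suff [P PW] : exists P : P1 K, hcoord Q ord_max * form_at f F0 P = hcoord Q ord0 * form_at f F1 P.
  by exists P; apply/eqP; rewrite map_P1_eq mulrC PW mulrC.
have [Wd|Wd] := eqVneq W`_d 0.
  exists None; apply/eqP; rewrite -subr_eq0 !form_atE /= (ev_hev hom0) (ev_hev hom1).
  by rewrite !hev_infty -Wd coefB !coefZ !coef_map.
have /closed_rootP[x /rootP Wx] : size W != 1%N.
  by apply: contra Wd => /eqP sW; rewrite nth_default // sW.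
exists (Some x); apply/eqP; rewrite -subr_eq0 !form_atE /= (ev_hev hom0) (ev_hev hom1).
by rewrite !hev_affine ?size_uni // -Wx hornerD hornerN !hornerZ.
Qed.

(** The pulled-back denominator is invariant under the linear lifts [anh_lin], so invariance of the
    fraction passes to the numerator. The scalar between [anh_lin] and normalized coordinates
    cancels, numerator and denominator having equal degree. *)
Lemma invariant_numerator (m n : nat) (F S : {mpoly k[2]}) (K : fieldType)
    (f : {rmorphism k -> K}) (P : P1 K) a :
  F \is m.-homog -> S \is (d * m * n).-homog -> a \in L ->
  form_at f (F \mPo [tuple F0; F1]) P != 0 ->
  form_at f S (anh_act a P) / form_at f (F \mPo [tuple F0; F1]) (anh_act a P) ^+ n =
    form_at f S P / form_at f (F \mPo [tuple F0; F1]) P ^+ n ->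
  ev f S (anh_lin a (hcoord P ord0) (hcoord P ord_max)).1
         (anh_lin a (hcoord P ord0) (hcoord P ord_max)).2 = form_at f S P.
Proof.
move=> homF homS aL nzP.
have FE c u v : ev f (F \mPo [tuple F0; F1]) (c * (anh_lin a u v).1) (c * (anh_lin a u v).2) =
    c ^+ (d * m) * ev f (F \mPo [tuple F0; F1]) u v.
  by rewrite !ev_comp (evZZ hom0) (evZZ hom1) inv0 // inv1 // (evZZ homF) exprM.
rewrite !form_atE /anh_act.
have [c c0 [-> ->]] := hcoord_of (anh_lin_neq0 a (hcoord_neq0 P)).
rewrite FE (evZZ homS) -!form_atE fraction_scale // => /mulIf; apply.
by rewrite invr_neq0 ?expf_neq0.
Qed.

(* At the generic point (X : 1) over the field k(X), invariance of the fraction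
   [S / F'^n] becomes an identity between polynomials. *)
Lemma generic_invariance (m n : nat) (F S : {mpoly k[2]}) :
  F \is m.-homog -> S \is (d * m * n).-homog -> uni (F \mPo [tuple F0; F1]) != 0 ->
  (forall (K : fieldType) (f : {rmorphism k -> K}) (P : P1 K) a, a \in L ->
     form_at f (F \mPo [tuple F0; F1]) P != 0 ->
     form_at f S (anh_act a P) / form_at f (F \mPo [tuple F0; F1]) (anh_act a P) ^+ n =
     form_at f S P / form_at f (F \mPo [tuple F0; F1]) P ^+ n) ->
  inv_poly (d * m * n) (uni S).
Proof.
move=> homF homS nzF invS; split=> [|a aL]; first exact: size_uni.
pose K : fieldType := {fraction {poly k}}.
pose t : {rmorphism {poly k} -> K} := @tofrac {poly k}.
pose f : {rmorphism k -> K} := t \o polyC.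
have tI : injective t by move=> x y /eqP; rewrite tofrac_eq => /eqP.
have t1 : t 1 = 1 by exact: rmorph1.
have tE (H : {mpoly k[2]}) u v : ev f H (t u) (t v) = t (ev polyC H u v).
  by rewrite (ev_rmorph polyC t).
have genE H : form_at f H (Some (t 'X)) = t (uni H) by rewrite form_atE /= -t1 tE.
apply: (tI); rewrite -(ev_hev homS) -tE !rmorph_anh_lin t1 -genE.
have nzP : form_at f (F \mPo [tuple F0; F1]) (Some (t 'X)) != 0.
  by rewrite genE -(rmorph0 t) (inj_eq tI).
exact: (invariant_numerator homF homS aL nzP (invS K f _ a aL nzP)).
Qed.

Definition form_of (N : nat) (c : nat -> k) : {mpoly k[2]} :=
  \sum_(i < N.+1) c i *: ('X_ord0 ^+ i * 'X_ord_max ^+ (N - i)).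

Lemma form_of_homog N c : form_of N c \is N.-homog.
Proof.
apply: rpred_sum => i _; apply: rpredZ.
have X j : 'X_j \is [in k[2], 1.-homog] by rewrite dhomogX; apply/eqP; exact: mdeg1.
have := dhomogM (dhomogMn i (X ord0)) (dhomogMn (N - i) (X ord_max)).
by rewrite !mul1n subnKC // -ltnS.
Qed.

(** The coefficients expressing [uni S] through [uni F0] and [uni F1] define [T]; homogenizing in
    degree [d * N] turns the identity of polynomials into one of forms. *)
Lemma descend (N : nat) (S : {mpoly k[2]}) : S \is (d * N).-homog -> inv_poly (d * N) (uni S) ->
  exists2 T : {mpoly k[2]}, T \is N.-homog &
    forall (K : fieldType) (f : {rmorphism k -> K}) (P : P1 K),
      form_at f S P = ev f T (form_at f F0 P) (form_at f F1 P).
Proof.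
move=> homS /gen[c SE]; exists (form_of N c); first exact: form_of_homog.
move=> K f P; rewrite !form_atE (ev_hev homS) SE hev_sum /form_of ev_sum.
apply: eq_bigr => i _; rewrite hevZ evZ evM !evXn ev0 ev1; congr (_ * _).
have iN : (i <= N)%N by rewrite -ltnS.
have size_pow F n : F \is d.-homog -> (size (uni F ^+ n) <= (d * n).+1)%N.
  move=> /size_uni sF; rewrite (leq_trans (size_poly_exp_leq _ _)) //.
  by rewrite ltnS leq_mul2r /= -subn1 leq_subLR add1n sF orbT.
have -> : (d * N = d * i + d * (N - i))%N by rewrite -mulnDr subnKC.
by rewrite hevM ?size_pow // !hevX ?size_uni // -!ev_hev.
Qed.

Lemma comp_homog (m : nat) (F : {mpoly k[2]}) : F \is m.-homog ->
  F \mPo [tuple F0; F1] \is (d * m).-homog.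
Proof.
move=> homF; rewrite comp_mpolyEX big_seq; apply: rpred_sum => x xF; apply: rpredZ.
rewrite comp_mpolyX big_ord_recl big_ord1 -(homog_mdeg homF xF) mulnDr.
rewrite [lift _ _](_ : _ = ord_max); last exact: val_inj.
by apply: dhomogM; apply: dhomogMn.
Qed.

Theorem coarse (gT : finGroupType) (G : {set gT})
    (act : forall K : fieldType, P1 K -> gT -> P1 K) :
  acts_by G act L -> coarse_space_is_P1 G act k.
Proof.
move=> [phi phiL actE].
have phi_in g : g \in G -> phi g \in L.
  by move=> gG; rewrite -(perm_mem phiL) map_f // mem_enum.
have phi_onto a : a \in L -> exists2 g, g \in G & phi g = a.
  by rewrite -(perm_mem phiL) => /mapP[g]; rewrite mem_enum => gG ->; exists g.
exists d, F0, F1; split=> [|K f P g gG|K f Q|K f P Q|m n F S homF homS F' invS].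
- by split.
- by rewrite actE map_P1_act // phi_in.
- exact: map_P1_surj.
- move=> E; have [|a /phi_onto[g gG <-] aPQ] := fib (f := f) (P := P) (Q := Q).
    have := map_P1_eq f P (map_P1 f F0 F1 Q); rewrite E eqxx /map_P1 => /esym/eqP.
    have [c c0 [-> ->]] := hcoord_of (nz f Q).
    by rewrite [LHS]mulrCA [RHS]mulrCA => /(mulfI c0).
  by exists g; rewrite ?actE.
(* If the pull-back vanishes identically, the open set is empty and the zero section serves.
   Otherwise [F'] is nonzero at the generic point. *)
have [F'0|nzF] := eqVneq (uni F') 0.
  exists 0%N, 0; split=> [|K f P]; first exact: rpred0.
  rewrite form_atE (ev_hev (comp_homog homF)) F'0 /hev big1 ?eqxx // => i _.
  by rewrite coef0 rmorph0 mul0r.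
have invp : inv_poly (d * (m * n)) (uni S).
  rewrite mulnA; apply: (generic_invariance homF) => // K f P a /phi_onto[g gG <-] nzP.
  by rewrite -!actE; apply: invS.
rewrite -mulnA in homS; have [T homT TE] := descend homS invp.
(* [T] and the n-th power of [F] both have degree [m * n], so the scalar from normalizing the image
   point cancels. *)
exists n, T; split=> // K f P nzP.
have [c c0 [h0 h1]] := hcoord_of (nz f P).
have FE : form_at f F' P = ev f F (form_at f F0 P) (form_at f F1 P).
  by rewrite !form_atE ev_comp.
rewrite FE TE [in RHS]form_atE [form_at f F _]form_atE h0 h1 (evZZ homT) (evZZ homF).
by rewrite fraction_scale.
Qed.

End Coarse.

(** * The six quotient maps *)

Section Divisibility.
Variable k : fieldType.
Implicit Types (p q : {poly k}) (x : k).

Lemma factor_root q x : q.[x] = 0 ->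
  exists2 r : {poly k}, size r = (size q).-1 & q = ('X - x%:P) * r.
Proof.
move=> /rootP/factor_theorem[r ->]; exists r; last exact: mulrC.
have [->|r0] := eqVneq r 0; first by rewrite mul0r size_poly0.
by rewrite size_Mmonic ?monicXsubC // size_XsubC addn2.
Qed.

Lemma size_drop D q : (size q <= D.+1)%N -> q`_D = 0 -> (size q <= D)%N.
Proof.
move=> sq qD; apply/leq_sizeP => j; rewrite leq_eqVlt => /orP[/eqP<- //|Dj].
by rewrite nth_default // (leq_trans sq).
Qed.

Lemma horner_hev D q (U V : {poly k}) x :
  (hev polyC D q U V).[x] = hev idfun D q U.[x] V.[x].
Proof.
rewrite /hev horner_sum; apply: eq_bigr => i _.
by rewrite !hornerM hornerC !horner_exp.
Qed.

Lemma hev_horner D q x : (size q <= D.+1)%N -> hev idfun D q x 1 = q.[x].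
Proof. by move=> sq; rewrite hev_affine // map_poly_id. Qed.

Lemma hev_scale (R : comNzRingType) (f : {rmorphism k -> R}) D q (c u v : R) :
  hev f D q (c * u) (c * v) = c ^+ D * hev f D q u v.
Proof.
rewrite /hev mulr_sumr; apply: eq_bigr => i _.
rewrite !exprMn mulrACA -exprD subnKC; last by rewrite -ltnS.
exact: mulrCA.
Qed.

(** A vanishing top coefficient is a zero at oo, which splits off the factor v. *)
Lemma hev_lower (R : comNzRingType) (f : {rmorphism k -> R}) D q (u v : R) :
  (size q <= D.+1)%N -> hev f D.+1 q u v = v * hev f D q u v.
Proof.
move=> sq; rewrite /hev big_ord_recr /= nth_default // rmorph0 mul0r addr0 mulr_sumr.
apply: eq_bigr => i _; rewrite subSn; last by rewrite -ltnS.
by rewrite exprS; ring.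
Qed.

Variables (L : seq anh) (D : nat) (q : {poly k}).
Hypothesis qinv : inv_poly L D q.

Lemma inv_poly_at a x : a \in L ->
  hev idfun D q (anh_lin a x 1).1 (anh_lin a x 1).2 = q.[x].
Proof.
move=> aL; rewrite -[in RHS](qinv.2 a aL) horner_hev.
by case: (a) => /=; rewrite ?hornerD ?hornerN ?hornerX ?hornerC.
Qed.

(** The coefficient of index [D] is the value of the form at oo = (1, 0). This and the next three
    lemmas spread a zero over its orbit in {0, 1, oo}. *)
Lemma inv_poly_At1 : At1 \in L -> q`_D = q.[0].
Proof. by move=> /inv_poly_at <-; rewrite /= hev_infty. Qed.

Lemma inv_poly_At2 : At2 \in L -> q.[1] = q.[0].
Proof. by move=> /inv_poly_at <-; rewrite /= subrr hev_horner // qinv.1. Qed.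

Lemma inv_poly_At3 : At3 \in L -> q`_D = q.[1].
Proof. by move=> /inv_poly_at <-; rewrite /= subrr hev_infty. Qed.

(** The lift of [Ar1] sends (0, 1) to -(1, 1) and (1, 1) to -(1, 0), which accounts for the
    signs. *)
Lemma inv_poly_Ar1 : Ar1 \in L -> q.[0] = (-1) ^+ D * q.[1] /\ q.[1] = (-1) ^+ D * q`_D.
Proof.
move=> aL; split; rewrite -{1}(inv_poly_at _ aL) /= ?sub0r ?subrr.
  by rewrite -[X in hev _ _ _ X X]mulr1 hev_scale hev_horner // qinv.1.
by rewrite -[X in hev _ _ _ X _]mulr1 -[X in hev _ _ _ _ X](mulr0 (-1)) hev_scale hev_infty.
Qed.

End Divisibility.

Section Instances.
Variable k : fieldType.
Local Notation X := ('X_ord0 : {mpoly k[2]}).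
Local Notation Y := ('X_ord_max : {mpoly k[2]}).
Variables (gT : finGroupType) (G : {set gT}).
Variable act : forall K : fieldType, P1 K -> gT -> P1 K.

Lemma homX : X \is 1.-homog. Proof. by rewrite dhomogX; apply/eqP; exact: mdeg1. Qed.
Lemma homY : Y \is 1.-homog. Proof. by rewrite dhomogX; apply/eqP; exact: mdeg1. Qed.
Lemma homXY : X - Y \is 1.-homog. Proof. exact: rpredB homX homY. Qed.

(** The factor at [a] is the bracket of aP and Q up to a nonzero scalar; over a field one factor of
    a zero product vanishes. *)
Lemma fib_of_factorization (L : seq anh) (F0 F1 : {mpoly k[2]}) (s : nat) :
  (forall (K : fieldType) (f : {rmorphism k -> K}) (u v x y : K),
     ev f F0 u v * ev f F1 x y - ev f F1 u v * ev f F0 x y =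
     (-1) ^+ s * \prod_(a <- L) ((anh_lin a u v).1 * y - (anh_lin a u v).2 * x)) ->
  forall (K : fieldType) (f : {rmorphism k -> K}) (P Q : P1 K),
    form_at f F0 P * form_at f F1 Q = form_at f F1 P * form_at f F0 Q ->
    exists2 a, a \in L & anh_act a P = Q.
Proof.
move=> H K f P Q /eqP; rewrite -subr_eq0 !form_atE H mulf_eq0 signr_eq0 /=.
rewrite prodf_seq_eq0 => /hasP[a aL /= E]; exists a => //.
by apply/eqP; rewrite anh_act_eq -subr_eq0.
Qed.

Lemma nz_of_common_zero (F0 F1 : {mpoly k[2]}) :
  (forall (K : fieldType) (f : {rmorphism k -> K}) (u v : K),
     ev f F0 u v = 0 -> ev f F1 u v = 0 -> u = 0 /\ v = 0) ->
  forall (K : fieldType) (f : {rmorphism k -> K}) (P : P1 K),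
    (form_at f F0 P != 0) || (form_at f F1 P != 0).
Proof.
move=> H K f P; rewrite -negb_and; apply/negP => /andP[/eqP h0 /eqP h1].
rewrite !form_atE in h0 h1; have [p0 p1] := H K f _ _ h0 h1.
by have := hcoord_neq0 P; rewrite p0 p1 eqxx.
Qed.

(** The map is x -> 1/x rather than the identity, so that [F1] vanishes at the base point 0 of
    [generated_forms]. *)
Lemma coarse_id : acts_by G act [:: Aid] -> coarse_space_is_P1 G act k.
Proof.
have i0 : inv_form [:: Aid] Y by move=> a; rewrite inE => /eqP->.
have i1 : inv_form [:: Aid] X by move=> a; rewrite inE => /eqP->.
apply: (coarse (ltn0Sn _) homY homX i0 i1).
- by apply: nz_of_common_zero => K f u v; rewrite !evE.
- apply: (@fib_of_factorization _ _ _ 1) => K f u v x y.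
  by rewrite !evE big_seq1 /=; ring.
- apply: (@generated_forms _ _ _ _ _ homY homX i0 i1 0); rewrite /uni !evE ?polyX_eq0 //.
    by rewrite hornerC oner_eq0.
  move=> N q [sq _] /factor_root[r sr qE]; exists r; last by rewrite {1}qE subr0.
  by rewrite sr; lia.
Qed.

(** The map is x + 1/x - 2: [F1] vanishes on the free orbit {0, oo}, [F0] doubly at the fixed point
    1. *)
Lemma coarse_At1 : acts_by G act [:: Aid; At1] -> coarse_space_is_P1 G act k.
Proof.
have h0 : (X - Y) ^+ 2 \is [in k[2], 2.-homog] := dhomogMn 2 homXY.
have h1 : X * Y \is [in k[2], 2.-homog] := dhomogM homX homY.
have i0 : inv_form [:: Aid; At1] ((X - Y) ^+ 2).
  by move=> a; rewrite !inE => /orP[]/eqP-> R f u v; rewrite !evE //=; ring.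
have i1 : inv_form [:: Aid; At1] (X * Y).
  by move=> a; rewrite !inE => /orP[]/eqP-> R f u v; rewrite !evE //=; ring.
apply: (coarse (ltn0Sn _) h0 h1 i0 i1).
- apply: nz_of_common_zero => K f u v; rewrite !evE => /eqP.
  rewrite expf_eq0 /= subr_eq0 => /eqP-> /eqP.
  by rewrite mulf_eq0 orbb => /eqP->.
- apply: (@fib_of_factorization _ _ _ 1) => K f u v x y.
  by rewrite !evE !big_cons big_nil /=; ring.
- apply: (@generated_forms _ _ _ _ _ h0 h1 i0 i1 0); rewrite /uni !evE.
  + by rewrite !hornerE /= expf_eq0 /= oppr_eq0 oner_eq0.
  + by rewrite mulr1 polyX_eq0.
  move=> N q qinv q0; have qD := inv_poly_At1 qinv isT.
  have [r sr qE] := factor_root q0; exists r; last by rewrite {1}qE subr0 mulr1.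
  have := size_drop qinv.1; rewrite qD q0 sr => /(_ erefl); lia.
Qed.

(** Here the free orbit is {0, 1}, and [F0] vanishes doubly at the fixed point oo. *)
Lemma coarse_At2 : acts_by G act [:: Aid; At2] -> coarse_space_is_P1 G act k.
Proof.
have h0 : Y ^+ 2 \is [in k[2], 2.-homog] := dhomogMn 2 homY.
have h1 : X * (X - Y) \is [in k[2], 2.-homog] := dhomogM homX homXY.
have i0 : inv_form [:: Aid; At2] (Y ^+ 2).
  by move=> a; rewrite !inE => /orP[]/eqP-> R f u v; rewrite !evE.
have i1 : inv_form [:: Aid; At2] (X * (X - Y)).
  by move=> a; rewrite !inE => /orP[]/eqP-> R f u v; rewrite !evE //=; ring.
apply: (coarse (ltn0Sn _) h0 h1 i0 i1).
- apply: nz_of_common_zero => K f u v; rewrite !evE => /eqP.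
  rewrite expf_eq0 /= => /eqP-> /eqP.
  by rewrite subr0 mulf_eq0 orbb => /eqP->.
- apply: (@fib_of_factorization _ _ _ 0) => K f u v x y.
  by rewrite !evE !big_cons big_nil /=; ring.
- apply: (@generated_forms _ _ _ _ _ h0 h1 i0 i1 0); rewrite /uni !evE.
  + by rewrite expr1n hornerC oner_eq0.
  + by rewrite mulf_neq0 ?polyX_eq0 ?polyXsubC_eq0.
  move=> N q qinv q0; have q1 := inv_poly_At2 qinv isT; have sq := qinv.1.
  have [r sr qE] := factor_root q0.
  have [|s ss rE] := @factor_root _ r 1.
    by move: q1; rewrite q0 qE hornerM hornerXsubC subr0 mul1r.
  exists s; last by rewrite {1}qE {1}rE subr0 mulrA.
  by rewrite ss sr; lia.
Qed.

Lemma coarse_At3 : acts_by G act [:: Aid; At3] -> coarse_space_is_P1 G act k.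
Proof.
have h0 : X ^+ 2 \is [in k[2], 2.-homog] := dhomogMn 2 homX.
have h1 : Y * (X - Y) \is [in k[2], 2.-homog] := dhomogM homY homXY.
have i0 : inv_form [:: Aid; At3] (X ^+ 2).
  by move=> a; rewrite !inE => /orP[]/eqP-> R f u v; rewrite !evE.
have i1 : inv_form [:: Aid; At3] (Y * (X - Y)).
  by move=> a; rewrite !inE => /orP[]/eqP-> R f u v; rewrite !evE //=; ring.
apply: (coarse (ltn0Sn _) h0 h1 i0 i1).
- apply: nz_of_common_zero => K f u v; rewrite !evE => /eqP.
  rewrite expf_eq0 /= => /eqP-> /eqP.
  by rewrite sub0r mulf_eq0 oppr_eq0 orbb => /eqP->.
- apply: (@fib_of_factorization _ _ _ 1) => K f u v x y.
  by rewrite !evE !big_cons big_nil /=; ring.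
(* The base point is 1, in the free orbit {1, oo}, since [At3] fixes 0 and [F0] vanishes there. *)
- apply: (@generated_forms _ _ _ _ _ h0 h1 i0 i1 1); rewrite /uni !evE.
  + by rewrite !hornerE /= expr1n oner_eq0.
  + by rewrite mul1r polyXsubC_eq0.
  move=> N q qinv q1; have qD := inv_poly_At3 qinv isT.
  have [r sr qE] := factor_root q1; exists r; last by rewrite {1}qE mul1r.
  have := size_drop qinv.1; rewrite qD q1 sr => /(_ erefl); lia.
Qed.

(** The quotient F0 / F1 is the sum over the orbit, x + 1/(1-x) + (x-1)/x. *)
Lemma coarse_rot : acts_by G act [:: Aid; Ar1; Ar2] -> coarse_space_is_P1 G act k.
Proof.
pose F0 := X ^+ 3 - X * Y ^+ 2 *+ 3 + Y ^+ 3; pose F1 := X * Y * (X - Y).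
have h0 : F0 \is [in k[2], 3.-homog].
  apply: rpredD (dhomogMn 3 homY); apply: rpredB (dhomogMn 3 homX) _.
  exact: rpredMn (dhomogM homX (dhomogMn 2 homY)).
have h1 : F1 \is [in k[2], 3.-homog] := dhomogM (dhomogM homX homY) homXY.
have i0 : inv_form [:: Aid; Ar1; Ar2] F0.
  by move=> a; rewrite !inE => /or3P[]/eqP-> R f u v; rewrite !evE //=; ring.
have i1 : inv_form [:: Aid; Ar1; Ar2] F1.
  by move=> a; rewrite !inE => /or3P[]/eqP-> R f u v; rewrite !evE //=; ring.
apply: (coarse (ltn0Sn _) h0 h1 i0 i1).
- apply: nz_of_common_zero => K f u v; rewrite /F0 /F1 !evE => e0 /eqP.
  rewrite !mulf_eq0 subr_eq0 -orbA => /or3P[]/eqP uv; move: e0; rewrite uv.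
  + rewrite (_ : _ + _ = v ^+ 3); last by ring.
    by move/eqP; rewrite expf_eq0 => /eqP.
  + rewrite (_ : _ + _ = u ^+ 3); last by ring.
    by move/eqP; rewrite expf_eq0 => /eqP.
  + rewrite (_ : _ + _ = - v ^+ 3); last by ring.
    by move/eqP; rewrite oppr_eq0 expf_eq0 => /eqP->.
- apply: (@fib_of_factorization _ _ _ 1) => K f u v x y.
  by rewrite !evE !big_cons big_nil /=; ring.
- apply: (@generated_forms _ _ _ _ _ h0 h1 i0 i1 0); rewrite /uni !evE.
  + rewrite (_ : _.[0] = 1) ?oner_eq0 // !hornerE /=; ring.
  + by rewrite mulr1 mulf_neq0 ?polyX_eq0 ?polyXsubC_eq0.
  move=> N q qinv q0; have [qA qB] := inv_poly_Ar1 qinv isT.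
  have q1 : q.[1] = 0 by apply/eqP; move/eqP: qA; rewrite q0 eq_sym mulf_eq0 signr_eq0.
  have qD : q`_(3 * N.+1) = 0.
    by apply/eqP; move/eqP: qB; rewrite q1 eq_sym mulf_eq0 signr_eq0.
  have [r sr qE] := factor_root q0.
  have [|s ss rE] := @factor_root _ r 1.
    by move: q1; rewrite qE hornerM hornerXsubC subr0 mul1r.
  exists s; last by rewrite {1}qE {1}rE subr0 mulr1 mulrA.
  have := size_drop qinv.1 qD; rewrite ss sr; lia.
Qed.

(* Only here the orbit {0, 1, oo} is not free, and divisibility by the square of
   the cubic form needs invariance once more, to double the zeros. *)
Lemma sym_invariant_divisible (D : nat) (q : {poly k}) :
  (2%:R : k) != 0 -> ~~ odd D -> (5 < D)%N ->
  inv_poly [:: Aid; At1; At2; At3; Ar1; Ar2] D q -> q.[0] = 0 ->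
  exists2 r : {poly k}, (size r <= D - 5)%N & q = ('X * ('X - 1)) ^+ 2 * r.
Proof.
move=> two evenD D5 qinv q0; have [sq qi] := qinv.
have q1 : q.[1] = 0 by rewrite (inv_poly_At2 qinv isT) q0.
have [p sp qE] := factor_root q0; rewrite subr0 in qE.
have hX (R : comNzRingType) (f : {rmorphism k -> R}) u v : hev f 1 'X u v = u.
  by rewrite (@hevXn _ _ f 1 1) // subnn expr0 mulr1 expr1.
have X0 : 'X != 0 :> {poly k} by rewrite polyX_eq0.
(* [At3] fixes 0 and keeps the first coordinate, so [p] = q/X is invariant in the odd degree D - 1.
   At the fixed point this reads p(0) = -p(0), and 2 is invertible, so the zero of [q] at 0 is
   double. *)
have pinv : hev polyC D.-1 p 'X ('X - 1) = p.
  apply: (mulfI X0); rewrite -[RHS]qE -[RHS](qi At3 isT) /= [in RHS]qE.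
  rewrite -[X in _ = hev _ X _ _ _](_ : 1 + D.-1 = D)%N; last by lia.
  by rewrite hevM ?size_polyX // ?hX // sp; lia.
have p0 : p.[0] = 0.
  have : hev idfun D.-1 p 0 (- 1) = p.[0].
    by rewrite -{2}pinv horner_hev !hornerE.
  have -> : (0 : k) = - 1 * 0 by rewrite mulr0.
  rewrite -[X in hev _ _ _ _ X]mulr1 hev_scale -signr_odd.
  rewrite (_ : odd D.-1); last by case: (D) evenD D5 => //= d; rewrite negbK.
  rewrite expr1 hev_horner; last by rewrite sp; lia.
  move=> /eqP; rewrite mulr0 mulN1r -subr_eq0 -opprD oppr_eq0 -mulr2n -mulr_natl.
  by rewrite mulf_eq0 (negPf two) => /eqP.
have [r sr pE] := factor_root p0; rewrite subr0 in pE.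
have {}qE : q = 'X ^+ 2 * r by rewrite qE {1}pE mulrA.
have hX2 (R : comNzRingType) (f : {rmorphism k -> R}) u v : hev f 2 'X^2 u v = u ^+ 2.
  by rewrite (@hevXn _ _ f 2 2) // subnn expr0 mulr1.
have sr1 : (size r <= (D - 2).+1)%N by rewrite sr sp; lia.
(* The swap [At1] carries the double zero from 0 to oo: the reversal of [r] is divisible by the
   square of X, so its two top coefficients vanish. *)
have rinv : hev polyC (D - 2) r 1 'X = 'X ^+ 2 * r.
  rewrite -[RHS]qE -[RHS](qi At1 isT) /= [in RHS]qE.
  rewrite -[X in _ = hev _ X _ _ _](_ : 2 + (D - 2) = D)%N; last by lia.
  by rewrite hevM ?size_polyXn // hX2 expr1n mul1r.
have sr2 : (size r <= D - 2)%N.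
  apply: size_drop => //; have := congr1 (horner^~ 0) rinv.
  by rewrite /= horner_hev hornerM hornerXn hornerX hornerC hev_infty expr0n mul0r.
have sr3 : (size r <= D - 3)%N.
  have E3 : (D - 2 = (D - 3).+1)%N by lia.
  rewrite E3 in sr2 rinv; apply: size_drop => //.
  move: rinv; rewrite hev_lower // expr2 -mulrA => /(mulfI X0) /(congr1 (horner^~ 0)).
  by rewrite /= horner_hev hornerM hornerX hornerC hev_infty mul0r.
have r1 : r.[1] = 0 by move: q1; rewrite qE hornerM hornerXn expr1n mul1r.
have [s ss rE] := factor_root r1.
(* Differentiating q(1 - X) = q(X) at 1 gives q'(1) = -q'(0) = 0, and q'(1) is s(1). *)
have s1 : s.[1] = 0.
  have : q \Po (1 - 'X) = q.
    by rewrite -[RHS](qi At2 isT) /= hev_affine.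
  move=> /(congr1 (fun p => (p^`()).[1])); rewrite deriv_comp.
  rewrite qE rE !derivE !hornerE /= horner_comp !hornerE /=.
  rewrite [X in X = _ -> _](_ : _ = 0); last by ring.
  by rewrite [X in _ = X -> _](_ : _ = s.[1]) => [<-|]; last by ring.
(* Three double zeros, one of them at oo, leave degree at most D - 6. *)
have [t st sE] := factor_root s1; exists t; first by rewrite st ss; lia.
by rewrite {1}qE {1}rE {1}sE; ring.
Qed.

(** The quotient F0 / F1 is the j-invariant of the Legendre curve with parameter x, up to the factor
    256. *)
Lemma coarse_sym : (2%:R : k) != 0 ->
  acts_by G act [:: Aid; At1; At2; At3; Ar1; Ar2] -> coarse_space_is_P1 G act k.
Proof.
move=> two; pose F0 := (X ^+ 2 - X * Y + Y ^+ 2) ^+ 3; pose F1 := (X * Y * (X - Y)) ^+ 2.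
have h0 : F0 \is [in k[2], 6.-homog].
  apply: (@dhomogMn _ _ _ 2 _ 3); apply: rpredD (dhomogMn 2 homY).
  exact: rpredB (dhomogMn 2 homX) (dhomogM homX homY).
have h1 : F1 \is [in k[2], 6.-homog].
  by apply: (@dhomogMn _ _ _ 3 _ 2); apply: dhomogM (dhomogM homX homY) homXY.
have i0 : inv_form [:: Aid; At1; At2; At3; Ar1; Ar2] F0.
  by case=> _ R f u v; rewrite !evE //=; ring.
have i1 : inv_form [:: Aid; At1; At2; At3; Ar1; Ar2] F1.
  by case=> _ R f u v; rewrite !evE //=; ring.
apply: (coarse (ltn0Sn _) h0 h1 i0 i1).
- apply: nz_of_common_zero => K f u v; rewrite /F0 /F1 !evE => e0 /eqP.
  rewrite expf_eq0 /= !mulf_eq0 subr_eq0 -orbA => /or3P[]/eqP uv; move: e0; rewrite uv.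
  + rewrite (_ : _ ^+ 3 = v ^+ 6); last by ring.
    by move/eqP; rewrite expf_eq0 => /eqP.
  + rewrite (_ : _ ^+ 3 = u ^+ 6); last by ring.
    by move/eqP; rewrite expf_eq0 => /eqP.
  + rewrite (_ : _ ^+ 3 = v ^+ 6); last by ring.
    by move/eqP; rewrite expf_eq0 => /eqP->.
- apply: (@fib_of_factorization _ _ _ 0) => K f u v x y.
  by rewrite !evE !big_cons big_nil /=; ring.
- apply: (@generated_forms _ _ _ _ _ h0 h1 i0 i1 0); rewrite /uni /F0 /F1 !evE.
  + rewrite (_ : _.[0] = 1) ?oner_eq0 // !hornerE /=; ring.
  + by rewrite expf_neq0 // mulr1 mulf_neq0 ?polyX_eq0 ?polyXsubC_eq0.
  move=> N q qinv q0.
  have [||r sr ->] := sym_invariant_divisible two _ _ qinv q0.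
  + by rewrite oddM.
  + lia.
  by exists r; [lia | rewrite mulr1].
Qed.

End Instances.

(** * Orders of points *)

(* The points with a nontrivial stabilizer in the anharmonic group: 0, 1, oo,
   -1, 1/2, 2 and the roots xi, 1 - xi of x^2 - x + 1. *)
Inductive special_point := S0 | S1 | Sinf | Sm1 | Shalf | S2 | Sxi | Sxi'.

Definition special_code (s : special_point) : nat :=
  match s with S0 => 0 | S1 => 1 | Sinf => 2 | Sm1 => 3 | Shalf => 4 | S2 => 5
             | Sxi => 6 | Sxi' => 7 end.
Definition specials := [:: S0; S1; Sinf; Sm1; Shalf; S2; Sxi; Sxi'].
Lemma special_codeK : cancel special_code (nth S0 specials). Proof. by case. Qed.
HB.instance Definition _ := Equality.copy special_point (can_type special_codeK).

Definition special_act (a : anh) (s : special_point) : special_point :=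
  match a, s with
  | Aid, _ => s
  | At1, S0 => Sinf | At1, S1 => S1 | At1, Sinf => S0
  | At2, S0 => S1 | At2, S1 => S0 | At2, Sinf => Sinf
  | At3, S0 => S0 | At3, S1 => Sinf | At3, Sinf => S1
  | Ar1, S0 => S1 | Ar1, S1 => Sinf | Ar1, Sinf => S0
  | Ar2, S0 => Sinf | Ar2, S1 => S0 | Ar2, Sinf => S1
  | At1, Sm1 => Sm1 | At1, Shalf => S2 | At1, S2 => Shalf
  | At2, Sm1 => S2 | At2, Shalf => Shalf | At2, S2 => Sm1
  | At3, Sm1 => Shalf | At3, Shalf => Sm1 | At3, S2 => S2
  | Ar1, Sm1 => Shalf | Ar1, Shalf => S2 | Ar1, S2 => Sm1
  | Ar2, Sm1 => S2 | Ar2, Shalf => Sm1 | Ar2, S2 => Shalf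
  | (At1 | At2 | At3), Sxi => Sxi' | (At1 | At2 | At3), Sxi' => Sxi
  | (Ar1 | Ar2), _ => s
  end.

Definition special_boundary := [:: S0; S1; Sinf].
Definition special_order (L : seq anh) (s : special_point) : nat :=
  count (fun a => special_act a s == s) L.

(** The conditions of [orbifold_type], read off the table [special_act]: [A] represents the boundary
    orbits and [B] the other orbits with nontrivial stabilizer. Computation decides it. *)
Definition orders_check (L : seq anh) (A B : seq special_point) : bool :=
  [&& uniq L, Aid \in L,
      all (fun a => all (fun s => special_act a s \in special_boundary) special_boundary) L,
      [&& all (mem special_boundary) A,
          all (fun s => has (fun a => special_act a s \in A) L) special_boundary,
          all (fun s => (s \notin special_boundary) && (1 < special_order L s)%N) B &
          all (fun s => (s \notin special_boundary) && (1 < special_order L s)%N ==>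
                        has (fun a => special_act a s \in B) L) specials],
      uniq A, uniq B &
      all (fun C => all (fun s => all (fun t =>
        has (fun a => special_act a s == t) L ==> (s == t)) C) C) [:: A; B]].

Section SpecialPoints.
Variables (K : fieldType) (xi : K).
Hypotheses (two : 2%:R != 0 :> K) (three : 3%:R != 0 :> K).
Hypothesis (xiE : xi ^+ 2 - xi + 1 = 0).

Let h : K := 2%:R^-1.
Let hE : h * 2%:R - 1 = 0. Proof. by rewrite mulVf // subrr. Qed.

Definition special_pt (s : special_point) : P1 K :=
  match s with
  | S0 => Some 0 | S1 => Some 1 | Sinf => None | Sm1 => Some (- 1)
  | Shalf => Some h | S2 => Some 2%:R | Sxi => Some xi | Sxi' => Some (1 - xi)
  end.

(** A nonzero constant in the ideal generated by x - y and the relations of [xi] and [h] certifies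
    that x and y differ. *)
Lemma neq_certificate (c al be ga x y : K) : c != 0 ->
  c = al * (x - y) + be * (xi ^+ 2 - xi + 1) + ga * (h * 2%:R - 1) -> x != y.
Proof. by move=> c0 E; apply: contra c0 => /eqP xy; rewrite E xy xiE hE subrr !mulr0 !addr0. Qed.

Lemma special_uniq : uniq [:: 0; 1; - 1; h; 2%:R; xi; 1 - xi].
Proof.
have one : 1 != 0 :> K := oner_neq0 K.
rewrite /= !inE !negb_or andbT -!andbA.
do 20?[apply/andP; split].
(* The 21 pairs come row by row: 0 against the six later points, then 1 against five, and so on. The
   constants are 1, 2 or 3. *)
- by apply: (@neq_certificate 1 (-1) 0 0) => //; ring.
- by apply: (@neq_certificate 1 1 0 0) => //; ring.
- by apply: (@neq_certificate 1 (- 2%:R) 0 (-1)) => //; ring.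
- by apply: (@neq_certificate 2%:R (-1) 0 0) => //; ring.
- by apply: (@neq_certificate 1 (xi - 1) 1 0) => //; ring.
- by apply: (@neq_certificate 1 (- xi) 1 0) => //; ring.
- by apply: (@neq_certificate 2%:R 1 0 0) => //; ring.
- by apply: (@neq_certificate 1 2%:R 0 1) => //; ring.
- by apply: (@neq_certificate 1 (-1) 0 0) => //; ring.
- by apply: (@neq_certificate 1 xi 1 0) => //; ring.
- by apply: (@neq_certificate 1 (1 - xi) 1 0) => //; ring.
- by apply: (@neq_certificate 3%:R (- 2%:R) 0 (-1)) => //; ring.
- by apply: (@neq_certificate 3%:R (-1) 0 0) => //; ring.
- by apply: (@neq_certificate 3%:R (xi - 2%:R) 1 0) => //; ring.
- by apply: (@neq_certificate 3%:R (- (xi + 1)) 1 0) => //; ring.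
- by apply: (@neq_certificate 3%:R (- 2%:R) 0 1) => //; ring.
- by apply: (@neq_certificate 3%:R (2%:R * (2%:R * xi - 1)) 4%:R (- (2%:R * xi - 1))) => //; ring.
- by apply: (@neq_certificate 3%:R (- (2%:R * (2%:R * xi - 1))) 4%:R (2%:R * xi - 1)) => //; ring.
- by apply: (@neq_certificate 3%:R (xi + 1) 1 0) => //; ring.
- by apply: (@neq_certificate 3%:R (2%:R - xi) 1 0) => //; ring.
- by apply: (@neq_certificate 3%:R (- (2%:R * xi - 1)) 4%:R 0) => //; ring.
Qed.

Lemma special_pt_inj : injective special_pt.
Proof.
have u : uniq [:: None; Some 0; Some 1; Some (- 1); Some h; Some 2%:R; Some xi;
                  Some (1 - xi)].
  have := special_uniq; rewrite -(map_inj_uniq (f := Some)) => [|x y [] //].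
  by move=> /= /andP[-> ->].
pose i s := nth 0%N [:: 1; 2; 0; 3; 4; 5; 6; 7]%N (special_code s).
have E s : special_pt s =
    nth None [:: None; Some 0; Some 1; Some (- 1); Some h; Some 2%:R; Some xi; Some (1 - xi)] (i s).
  by case: s.
have li s : (i s < 8)%N by case: s.
move=> s t; rewrite !E => /eqP; rewrite nth_uniq //.
by case: s; case: t.
Qed.

(** After cross-multiplication the difference is 0 or, up to sign, the relation defining [h] or
    [xi]. *)
Lemma special_ptP a s : anh_act a (special_pt s) = special_pt (special_act a s).
Proof.
apply/eqP; rewrite anh_act_eq -subr_eq0; move: hE xiE.
case: a; case: s => /= H1 H2.
all: first [ rewrite (_ : _ - _ * _ = 0); [by rewrite eqxx | ring]
  | rewrite (_ : _ - _ * _ = h * 2%:R - 1); [by rewrite H1 | ring]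
  | rewrite (_ : _ - _ * _ = - (h * 2%:R - 1)); [by rewrite oppr_eq0 H1 | ring]
  | rewrite (_ : _ - _ * _ = xi ^+ 2 - xi + 1); [by rewrite H2 | ring]
  | rewrite (_ : _ - _ * _ = - (xi ^+ 2 - xi + 1)); [by rewrite oppr_eq0 H2 | ring]].
Qed.

(** The fixed-point equation of each non-identity element has degree at most 2 and splits over the
    special points. *)
Lemma fixed_special a (P : P1 K) : a != Aid -> anh_act a P = P ->
  exists s, P = special_pt s.
Proof.
case: P => [x|]; last by exists Sinf.
move=> a1 /eqP; rewrite anh_act_eq -subr_eq0 => E.
case: a a1 E => //= _.
- rewrite (_ : _ - _ = - ((x - 1) * (x - - 1))); last by ring.
  rewrite oppr_eq0 mulf_eq0 !subr_eq0 => /orP[]/eqP->; [by exists S1 | by exists Sm1].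
(* The equation for [At2] is linear, its other fixed point being oo. *)
- rewrite (_ : _ - _ = - 2%:R * (x - h) - (h * 2%:R - 1)); last by ring.
  by rewrite hE subr0 mulf_eq0 oppr_eq0 (negPf two) subr_eq0 => /eqP->; exists Shalf.
- rewrite (_ : _ - _ = - ((x - 0) * (x - 2%:R))); last by ring.
  rewrite oppr_eq0 mulf_eq0 !subr_eq0 => /orP[]/eqP->; [by exists S0 | by exists S2].
- rewrite (_ : _ - _ = - ((x - xi) * (x - (1 - xi)) + (xi ^+ 2 - xi + 1))); last by ring.
  rewrite xiE addr0 oppr_eq0 mulf_eq0 !subr_eq0.
  by move=> /orP[]/eqP->; [exists Sxi | exists Sxi'].
- rewrite (_ : _ - _ = (x - xi) * (x - (1 - xi)) + (xi ^+ 2 - xi + 1)); last by ring.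
  rewrite xiE addr0 mulf_eq0 !subr_eq0.
  by move=> /orP[]/eqP->; [exists Sxi | exists Sxi'].
Qed.

End SpecialPoints.

Section OrbifoldType.
Variables (gT : finGroupType) (G : {set gT}).
Variable act : forall K : fieldType, P1 K -> gT -> P1 K.
Variable L : seq anh.
Hypothesis actL : acts_by G act L.
Variables (K : fieldType) (xi : K).
Hypotheses (two : 2%:R != 0 :> K) (three : 3%:R != 0 :> K).
Hypothesis (xiE : xi ^+ 2 - xi + 1 = 0).

Local Notation pt := (special_pt xi).

Lemma same_orbit_anh (P Q : P1 K) :
  same_orbit G act P Q <-> exists2 a, a \in L & anh_act a P = Q.
Proof.
have [phi phiL actE] := actL; split=> [[g gG <-]|[a]].
  by exists (phi g); rewrite ?actE // -(perm_mem phiL) map_f // mem_enum.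
rewrite -(perm_mem phiL) => /mapP[g]; rewrite mem_enum => gG -> <-.
by exists g; rewrite ?actE.
Qed.

Lemma point_order_anh (P : P1 K) :
  point_order G act P = count (fun a => anh_act a P == P) L.
Proof.
have [phi phiL actE] := actL.
rewrite /point_order -(seq.permP phiL) count_map cardE -size_filter.
apply/perm_size/uniq_perm => [||g].
- exact: enum_uniq.
- by rewrite filter_uniq // enum_uniq.
by rewrite mem_enum mem_filter mem_enum inE actE andbC.
Qed.

Lemma special_ptE s t : (pt s == pt t) = (s == t).
Proof. exact: inj_eq (special_pt_inj two three xiE) _ _. Qed.

Lemma special_orbit s t : same_orbit G act (pt s) (pt t) <->
  has (fun a => special_act a s == t) L.
Proof.
rewrite same_orbit_anh; split=> [[a aL /eqP]|/hasP[a aL]].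
  by rewrite special_ptP // special_ptE => h; apply/hasP; exists a.
by move=> /eqP<-; exists a; rewrite ?special_ptP.
Qed.

Lemma special_point_order s : point_order G act (pt s) = special_order L s.
Proof.
by rewrite point_order_anh; apply: eq_count => a; rewrite special_ptP // special_ptE.
Qed.

Lemma orders_of_special (X : P1 K -> Prop) (C : seq special_point) :
  uniq C -> (forall s, s \in C -> X (pt s)) ->
  (forall P, X P -> exists2 s, P = pt s & has (fun a => special_act a s \in C) L) ->
  all (fun s => all (fun t => has (fun a => special_act a s == t) L ==> (s == t)) C) C ->
  orders_of G act X (map (special_order L) C).
Proof.
move=> uC CX XC ineq; exists (map pt C); split.
- by move=> _ /mapP[s sC ->]; apply: CX.
- move=> _ /XC[s -> /hasP[a aL sC]]; exists (pt (special_act a s)); first exact: map_f.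
  by apply/special_orbit/hasP; exists a.
- move=> i j; rewrite size_map => iC jC; rewrite !(nth_map S0) // => /special_orbit H.
  apply/eqP; rewrite -(nth_uniq S0 iC jC uC).
  by have /allP/(_ _ (mem_nth S0 iC))/allP/(_ _ (mem_nth S0 jC)) := ineq; rewrite H.
- by rewrite -map_comp (eq_map special_point_order).
Qed.

Lemma orbifold_type_special (A B : seq special_point) : orders_check L A B ->
  orbifold_type G act K (map (special_order L) A) (map (special_order L) B).
Proof.
case/and5P=> uL idL stab /and4P[AB Acov Bnb Bcov] /and3P[uA uB /and3P[iA iB _]].
have bdE (P : P1 K) : P \in @boundary K <-> exists2 s, s \in special_boundary & P = pt s.
  split=> [|[s sb ->]]; [|move: sb]; rewrite !inE => /or3P[]/eqP->; rewrite ?eqxx ?orbT //.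
  - by exists S0.
  - by exists S1.
  - by exists Sinf.
(* {0, 1, oo} is stable under [L], so the boundary is its own saturation. *)
have imE P : boundary_image G act P <-> P \in @boundary K.
  split=> [[Q /bdE[s sb ->]]|Pb]; last first.
    by exists P => //; apply/same_orbit_anh; exists Aid; rewrite // /anh_act of_hcoordK.
  move=> /same_orbit_anh[a aL <-]; apply/bdE; exists (special_act a s).
    exact: (allP (allP stab a aL) s sb).
  by rewrite special_ptP.
have nbE s : ~ boundary_image G act (pt s) <-> s \notin special_boundary.
  rewrite imE bdE; split=> [H|/negP H [t tb /eqP]]; first by apply/negP => sb; apply: H; exists s.
  by rewrite special_ptE => /eqP st; apply: H; rewrite st.
split; apply: orders_of_special => //.
- by move=> s sA; apply/imE/bdE; exists s => //; apply: (allP AB).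
- by move=> P /imE/bdE[s sb ->]; exists s => //; apply: (allP Acov).
- move=> s sB; have /andP[nb o1] := allP Bnb s sB.
  by split; [apply/nbE | rewrite special_point_order].
(* A stabilizer of order above 1 contains a non-identity element, because [Aid] occurs only once in
   [L]; its fixed points are special. *)
move=> P [nb o1]; have [s PE] : exists s, P = pt s.
  rewrite point_order_anh in o1.
  have : has (fun a => (anh_act a P == P) && (a != Aid)) L.
    apply: contraLR o1; rewrite -all_predC -leqNgt => /allP H.
    apply: (@leq_trans (count_mem Aid L)); last by rewrite count_uniq_mem ?leq_b1.
    rewrite -!size_filter; apply: uniq_leq_size; first exact: filter_uniq.
    move=> a; rewrite !mem_filter => /andP[aP aL]; rewrite aL andbT.
    by have := H a aL; rewrite /= aP /= negbK.
  by case/hasP=> a _ /andP[/eqP aP a1]; apply: (fixed_special two xiE a1 aP).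
exists s => //; rewrite PE in nb o1.
have sS : s \in specials by case: (s).
have /implyP := allP Bcov s sS; apply; apply/andP; split; first exact/nbE.
by rewrite -special_point_order.
Qed.

End OrbifoldType.

(** * Isomorphism types and the final case analysis *)

Lemma isog_Zp_prime (gT : finGroupType) (D : {group gT}) (p : nat) :
  prime p -> #|D| = p -> D \isog [set: 'Z_p].
Proof.
move=> pp Dp; have cZ : #|[set: 'Z_p]| = p by rewrite cardsT card_ord Zp_cast // prime_gt1.
rewrite isog_cyclic_card; last by apply: prime_cyclic; rewrite Dp.
by rewrite cZ Dp eqxx andbT; apply: prime_cyclic; rewrite cZ.
Qed.

Lemma cardsT_S3 : #|[set: 'S_3]| = 6.
Proof. by rewrite cardsT card_Sn. Qed.

Lemma isog_S3 (D : {group 'S_3}) : #|D| = 6 -> D \isog [set: 'S_3].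
Proof.
move=> D6; suff -> : D = [set: 'S_3]%G by exact: isog_refl.
by apply/val_inj/eqP; rewrite eqEcard subsetT cardsT_S3 D6.
Qed.

(** In characteristic 3, x^2 - x + 1 is the square of x + 1, so -1 would be the only cube root of
    -1. *)
Lemma cube_root_of_minus1 (K : fieldType) (xi : K) : xi != -1 -> xi ^+ 3 = -1 ->
  xi ^+ 2 - xi + 1 = 0 /\ 3%:R != 0 :> K.
Proof.
rewrite -subr_eq0 opprK => n E.
have xiE : xi ^+ 2 - xi + 1 = 0.
  apply/eqP; have /eqP : (xi ^+ 2 - xi + 1) * (xi + 1) = 0.
    by rewrite (_ : _ * _ = xi ^+ 3 + 1); [rewrite E addNr | ring].
  by rewrite mulf_eq0 (negPf n) orbF.
split=> //; apply: contra n => /eqP three; suff: (xi + 1) ^+ 2 == 0 by rewrite expf_eq0.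
by rewrite (_ : _ ^+ 2 = xi ^+ 2 - xi + 1 + 3%:R * xi); [rewrite xiE three mul0r add0r | ring].
Qed.

Theorem mainTheorem6 (k : fieldType) (xi : k)
    (char_k : 2%N \notin [pchar k])
    (xi_neq : xi != -1) (xi3 : xi ^+ 3 = -1)
    (Gam : wgraph)
    (stableG : stable_graph Gam)
    (edgesG : #|edges Gam|%:Z = 3 * genus Gam - 4)
    (weightG : total_weight Gam = 0%N)
    (v0 : vertex Gam) (deg_v0 : vdeg v0 = 4%N)
    (e : 4.-tuple (halfedge Gam)) (labelling : perm_eq e (enum (star v0))) :
  [/\ [\/ Rgroup e = 1%g, Rgroup e \isog [set: 'Z_2],
          Rgroup e \isog [set: 'Z_3] | Rgroup e \isog [set: 'S_3]],
      coarse_space_is_P1 (Rgroup e) (@R_act Gam e) k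
    & forall (K : fieldType) (f : {rmorphism k -> K}),
        let type := @orbifold_type _ (Rgroup e) (@R_act Gam e) K in
        [/\ Rgroup e = 1%g -> type [:: 1; 1; 1]%N [::],
            Rgroup e \isog [set: 'Z_2] -> type [:: 1; 2]%N [:: 2]%N,
            Rgroup e \isog [set: 'Z_3] -> type [:: 1]%N [:: 3; 3]%N
          & Rgroup e \isog [set: 'S_3] -> type [:: 2]%N [:: 2; 3]%N]].
Proof.
have [xiE three] := cube_root_of_minus1 xi_neq xi3.
have two : 2%:R != 0 :> k by apply: contra char_k => h2; rewrite inE /= h2.
(* Being the only vertex of degree 4, [v0] is fixed by all automorphisms, so [sigma] is a
   homomorphism. *)
have uniq4 v : vdeg v = 4%N -> v = v0.
  have [w [_ w3]] := deg4_vertex stableG edgesG weightG.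
  have W u : vdeg u = 4%N -> u = w.
    by move=> u4; apply/eqP; apply: contraT => /w3; rewrite u4.
  by move=> /W->; rewrite (W v0).
have [D isoD [L LS [sL actL]]] := Rgroup_acts_by labelling uniq4.
have cR : #|Rgroup e| = size L by rewrite (card_isog isoD).
have Z p : prime p -> size L = p -> Rgroup e \isog [set: 'Z_p].
  by move=> pp Lp; apply: isog_trans isoD _; apply: isog_Zp_prime; rewrite // -sL.
have toSize (gT : finGroupType) (M : {group gT}) : Rgroup e \isog M -> size L = #|M|.
  by move=> /card_isog <-.
(* The order separates the four isomorphism types, so each premise of the table discards the
   subgroups of other sizes. *)
have [s1 s2 s3 s6] : [/\ Rgroup e = 1%g -> size L = 1%N,
    Rgroup e \isog [set: 'Z_2] -> size L = 2, Rgroup e \isog [set: 'Z_3] -> size L = 3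
    & Rgroup e \isog [set: 'S_3] -> size L = 6].
  split; first by rewrite -cR => ->; exact: cards1.
  - by move=> /toSize->; rewrite cardsT card_ord.
  - by move=> /toSize->; rewrite cardsT card_ord.
  - by move=> /toSize->; rewrite cardsT_S3.
have orb (A B : seq special_point) : orders_check L A B ->
    forall (K : fieldType) (f : {rmorphism k -> K}),
    orbifold_type (Rgroup e) (@R_act Gam e) K (map (special_order L) A) (map (special_order L) B).
  move=> LAB K f; apply: (orbifold_type_special actL (xi := f xi)) => //.
  - by rewrite -(rmorph_nat f) fmorph_eq0.
  - by rewrite -(rmorph_nat f) fmorph_eq0.
  - by rewrite -rmorphXn -rmorphB -(rmorph1 f) -rmorphD xiE rmorph0.
(* One representative per orbit for each of the six subgroups; for those of order 2 the
   representatives with stabilizer of order 2 are the two fixed points, one of them in the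
   boundary. *)
have [k0 k1 k2 [k3 kr ks]] : [/\ orders_check [:: Aid] special_boundary [::],
    orders_check [:: Aid; At1] [:: S0; S1] [:: Sm1],
    orders_check [:: Aid; At2] [:: S0; Sinf] [:: Shalf]
    & [/\ orders_check [:: Aid; At3] [:: S1; S0] [:: S2],
    orders_check [:: Aid; Ar1; Ar2] [:: S0] [:: Sxi; Sxi'] &
    orders_check [:: Aid; At1; At2; At3; Ar1; Ar2] [:: S0] [:: Sm1; Sxi]]] by [].
move: LS; rewrite !inE => /or4P[/eqP EL|/eqP EL|/eqP EL|/or3P[]/eqP EL]; subst L.
- split; [apply: Or41 | exact: coarse_id actL |].
    apply/eqP; have := trivg_card1 (graph_aut_group Gam / sigma_preim_V4 e)%G.
    by rewrite -[#|_|]/#|Rgroup e| cR => ->.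
  by move=> K f; split=> [_|/s2|/s3|/s6] //; exact: orb k0 K f.
- split; [by apply: Or42; exact: Z | exact: coarse_At1 actL |].
  by move=> K f; split=> [/s1|_|/s3|/s6] //; exact: orb k1 K f.
- split; [by apply: Or42; exact: Z | exact: coarse_At2 actL |].
  by move=> K f; split=> [/s1|_|/s3|/s6] //; exact: orb k2 K f.
- split; [by apply: Or42; exact: Z | exact: coarse_At3 actL |].
  by move=> K f; split=> [/s1|_|/s3|/s6] //; exact: orb k3 K f.
- split; [by apply: Or43; exact: Z | exact: coarse_rot actL |].
  by move=> K f; split=> [/s1|/s2|_|/s6] //; exact: orb kr K f.
- split; [|exact: coarse_sym two actL |].
    by apply: Or44; apply: isog_trans isoD _; apply: isog_S3; rewrite -sL.
  by move=> K f; split=> [/s1|/s2|/s3|_] //; exact: orb ks K f.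
Qed.
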